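(* Let $t_k=1/\log k$ for $k=2,3,4,\dots$, and for $f\in L^2(\mathbb{R}^n)$ set $$S^*f(x)=\sup_{k\ge2}|S_{t_k}f(x)|,\qquad x\in\mathbb{R}^n.$$ Then $S^*$ is not a bounded operator on $L^2(\mathbb{R}^n)$ (that is, there is no constant $C$ such that $\|S^*f\|_2\le C\|f\|_2$ for all $f\in L^2(\mathbb{R}^n)$) in the case $n=1$, $a>1$, and also in the case $n\ge2$, $a=2$.
   Context: The Fourier transform is $\hat f(\xi)=\int_{\mathbb{R}^n}e^{-i\xi\cdot x}f(x)\,dx$. For $f\in L^2(\mathbb{R}^n)$ and $a>0$, $S_tf(x)=(2\pi)^{-n}\int_{\mathbb{R}^n}e^{i\xi\cdot x}e^{it|\xi|^a}\hat f(\xi)\,d\xi$, i.e. $S_tf$ is the $L^2$ function with Fourier transform $e^{it|\xi|^a}\hat f(\xi)$. *)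

(* Defs.v *)
From HB Require Import structures.
From mathcomp Require Import all_boot all_order all_algebra.
From mathcomp Require Import all_classical all_reals all_analysis.
From mathcomp Require Import complex.

Set Implicit Arguments.
Unset Strict Implicit.
Unset Printing Implicit Defensive.

Import Order.TTheory GRing.Theory Num.Theory.
Import numFieldNormedType.Exports.

Local Open Scope classical_set_scope.
Local Open Scope ring_scope.
Local Open Scope complex_scope.

(* R^n is the type n.-tuple R with the library's product sigma-algebra, which
   is the Borel sigma-algebra of R^n. The library has no Lebesgue measure on
   it, so it is built here as the n-fold product of lebesgue_measure;
   lebesgue_measure_nE computes it on measurable boxes. *)

Definition cons_pair {T : Type} {n : nat} (p : T * n.-tuple T) : n.+1.-tuple T :=
  [the n.+1.-tuple T of p.1 :: p.2].

Lemma measurable_cons_pair d (T : measurableType d) n :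
  measurable_fun [set: T * n.-tuple T] (@cons_pair T n).
Proof. exact: measurable_cons. Qed.

Section lebesgue_cons.
Local Open Scope ereal_scope.
Context {R : realType} {n : nat}.
Variable mu : {sigma_finite_measure set (n.-tuple R) -> \bar R}.

Definition lebesgue_cons : set (n.+1.-tuple R) -> \bar R :=
  pushforward (@lebesgue_measure R \x mu) (@cons_pair R n).

Let mcons A : measurable A -> measurable (@cons_pair R n @^-1` A).
Proof. by move=> mA; rewrite -[X in measurable X]setTI; exact: measurable_cons_pair. Qed.

Let lebesgue_cons0 : lebesgue_cons set0 = 0.
Proof. by rewrite /lebesgue_cons /pushforward preimage_set0 measure0. Qed.

Let lebesgue_cons_ge0 A : 0 <= lebesgue_cons A.
Proof. by rewrite /lebesgue_cons /pushforward measure_ge0. Qed.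

Let lebesgue_cons_sigma_additive : semi_sigma_additive lebesgue_cons.
Proof.
move=> F mF tF mUF; rewrite /lebesgue_cons /pushforward preimage_bigcup.
apply: measure_semi_sigma_additive.
- by move=> k; exact: mcons.
- apply/trivIsetP => /= i j _ _ ij; rewrite -preimage_setI.
  by move/trivIsetP : tF => /(_ _ _ _ _ ij) ->//; rewrite preimage_set0.
- by rewrite -preimage_bigcup; exact: mcons.
Qed.

HB.instance Definition _ := isMeasure.Build _ _ _ lebesgue_cons
  lebesgue_cons0 lebesgue_cons_ge0 lebesgue_cons_sigma_additive.

Let msplit : measurable_fun [set: n.+1.-tuple R]
  (fun x => (thead x, [tuple of behead x]) : R * n.-tuple R).
Proof.
by apply/measurable_fun_pair; [exact: measurable_tnth|exact: measurable_behead].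
Qed.

Let split_cons (p : R * n.-tuple R) :
  (thead (cons_pair p), [tuple of behead (cons_pair p)]) = p.
Proof. by case: p => a t; congr pair; apply/val_inj. Qed.

Let lebesgue_cons_sigma_finite : sigma_finite setT lebesgue_cons.
Proof.
have /sigma_finiteP[F [TF ndF Foo]] := sigma_finiteT (@lebesgue_measure R).
have /sigma_finiteP[G [TG ndG Goo]] := sigma_finiteT mu.
pose s := fun x : n.+1.-tuple R =>
  (thead x, [tuple of behead x]) : R * n.-tuple R.
exists (fun k => s @^-1` (F k `*` G k)).
  apply/seteqP; split => // x _.
  have [i _ Fi] : (\bigcup_i F i) (thead x) by rewrite -TF.
  have [j _ Gj] : (\bigcup_i G i) [tuple of behead x] by rewrite -TG.
  exists (maxn i j) => //; split.
    by move: Fi; exact/subsetPset/ndF/leq_maxl.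
  by move: Gj; exact/subsetPset/ndG/leq_maxr.
move=> k; have [mF Fk] := Foo k; have [mG Gk] := Goo k; split.
  rewrite -[X in measurable X]setTI; apply: msplit => //.
  exact: measurableX.
rewrite /lebesgue_cons /pushforward.
rewrite (_ : _ @^-1` _ = F k `*` G k); last first.
  have sK p : s (cons_pair p) = p := split_cons p.
  by apply/seteqP; split => p h; [rewrite -(sK p)|rewrite -(sK p) in h].
by rewrite product_measure1E// lte_mul_pinfty// ge0_fin_numE.
Qed.

HB.instance Definition _ := Measure_isSigmaFinite.Build _ _ _ lebesgue_cons
  lebesgue_cons_sigma_finite.

End lebesgue_cons.

Fixpoint lebesgue_measure_n (R : realType) (n : nat) :
    {sigma_finite_measure set (n.-tuple R) -> \bar R} :=
  match n return {sigma_finite_measure set (n.-tuple R) -> \bar R} with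
  | 0 => \d_[tuple]
  | m.+1 => lebesgue_cons (lebesgue_measure_n R m)
  end.

Lemma lebesgue_measure_nE (R : realType) (n : nat) (A : 'I_n -> set R) :
  (forall i, measurable (A i)) ->
  lebesgue_measure_n R n [set x | forall i, A i (tnth x i)] =
  (\prod_(i < n) lebesgue_measure (A i))%E.
Proof.
elim: n A => [|n IHn] A mA /=.
  rewrite big_ord0 diracE mem_set// => -[].
  by [].
rewrite big_ord_recl -IHn//.
have mB : measurable [set x : n.-tuple R | forall i, A (lift ord0 i) (tnth x i)].
  rewrite (_ : [set _ | _] =
      \bigcap_(i in [set: 'I_n]) ((@tnth n R)^~ i @^-1` A (lift ord0 i))); last first.
    by apply/seteqP; split => x h i //=; exact: h.
  apply: fin_bigcap_measurable => // i _.
  by rewrite -[X in measurable X]setTI; exact: measurable_tnth.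
rewrite -product_measure1E//; last exact: mA.
rewrite /lebesgue_cons /pushforward.
congr product_measure1; apply/seteqP; split=> -[x y] /=.
  move=> h; split; first exact: (h ord0).
  by move=> i; have := h (lift ord0 i); rewrite /cons_pair tnthS.
move=> [h0 h1] i; case: (unliftP ord0 i) => [j|] ->; last exact: h0.
by rewrite /cons_pair tnthS; exact: h1.
Qed.

Section fourier.
Context {R : realType} {n : nat}.
Implicit Types (x xi : n.-tuple R) (f g F : n.-tuple R -> R[i]).

Definition dotp xi x : R := \sum_(i < n) tnth xi i * tnth x i.

Definition enorm xi : R := Num.sqrt (\sum_(i < n) tnth xi i ^+ 2).

Definition cis (theta : R) : R[i] := cos theta +i* sin theta.

(* The modulus as an element of R; `|z| would lie in R[i]. *)
Definition cabs (z : R[i]) : R := ComplexField.Normc.normc z.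

Definition cintegral f : R[i] :=
  (\int[lebesgue_measure_n R n]_x complex.Re (f x)) +i*
  (\int[lebesgue_measure_n R n]_x complex.Im (f x)).

Definition cnorm (p : \bar R) f : \bar R :=
  'N[lebesgue_measure_n R n]_p [(fun x => (cabs (f x))%:E)]%E.

(* Complex-valued L^p functions, before identification of functions that are
   equal almost everywhere. *)
Definition Lp (p : \bar R) f : Prop :=
  [/\ measurable_fun setT (fun x => complex.Re (f x)),
      measurable_fun setT (fun x => complex.Im (f x)) &
      (cnorm p f < +oo)%E].

(* Meaningful for f in L^1. *)
Definition fourier f : n.-tuple R -> R[i] :=
  fun xi => cintegral (fun x => cis (- dotp xi x) * f x).

(* F is (a version of) the Fourier transform of f in L^2: the extension of
   [fourier] by L^2-continuity from the dense subspace of L^1 functions in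
   L^2. *)
Definition fourierL2 f F : Prop :=
  [/\ Lp 2%:E f, Lp 2%:E F &
      exists u : nat -> n.-tuple R -> R[i],
        [/\ forall k, Lp 1 (u k) /\ Lp 2%:E (u k),
            cnorm 2%:E (fun x => u k x - f x) @[k --> \oo] --> 0%E &
            cnorm 2%:E (fun xi => fourier (u k) xi - F xi) @[k --> \oo] --> 0%E]].

(* g is (a version of) S_t f. *)
Definition propagator (a t : R) f g : Prop :=
  exists2 F, fourierL2 f F &
    fourierL2 g (fun xi => cis (t * enorm xi `^ a) * F xi).

(* s is (a version of) S^* f; the supremum may be infinite. Distinct versions
   agree almost everywhere, as the supremum is countable. *)
Definition maximal_function (a : R) f (s : n.-tuple R -> \bar R) : Prop :=
  exists2 g : nat -> n.-tuple R -> R[i],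
    forall k, (2 <= k)%N -> propagator a (ln k%:R)^-1 f (g k) &
    forall x, s x = ereal_sup [set (cabs (g k x))%:E | k in [set k | (2 <= k)%N]].

End fourier.

(* Main.v *)
(** Let [f] be the function with Fourier transform a bump on the frequencies
    [[M, M + 1]]. Under the flow, the packet [f] moves with velocity
    [- a M^(a-1)] and keeps its height as long as
    [a t ((M + 1)^(a-1) - M^(a-1))] is small. Put [W = a M^(a-1)]. The packet is
    at the point [-T], [1 <= T <= L], at the time [T / W]; near that time the
    gaps between consecutive [1 / log k] are about [e^(- W / T)], much smaller
    than [1 / W], so some [t_k] catches the packet there. Hence [S^* f] is bounded
    below on a set of measure of order [L], whereas [|f|], and so its norm, does
    not depend on [M]; let [M], then [L], tend to infinity. When [a = 2] the
    symbol [e^(i t |xi|^2)] factors, and tensor products of one-dimensional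
    packets, with a high frequency in the first variable only, do the job.

    That the packets solve the equation is Fourier inversion, obtained by Abel
    summation: the weight [e^(- eps |x|)] turns the double integral into a Poisson
    integral of the bump. *)

Require Import Defs.
From mathcomp Require Import all_boot all_order all_algebra.
From mathcomp Require Import all_classical all_reals all_analysis.
From mathcomp Require Import complex.
From mathcomp Require Import measurable_realfun ring lra.
Import Order.TTheory GRing.Theory Num.Theory.
Import numFieldNormedType.Exports.
Local Open Scope ring_scope.
Local Open Scope complex_scope.
Local Open Scope classical_set_scope.

(** The L^2 Fourier transform is defined through approximation by integrable functions. The packets
    are made integrable as well as square integrable, so that their transforms are honest integrals
    and the approximating sequence is constant. The decay [K / (1 + x ^ 2)] gives both, and it costs
    two integrations by parts, whence a bump with double zeros at both ends of its support. All
    oscillatory integrals are real ones over [[0, 1]], of the form [p e * cos (x * e + c)]. The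
    carrier frequency [M] enters only through the phase [c], which the decay estimate does not see;
    that is why the norm of the initial packet has a bound free of [M]. The lower bound needs a
    total phase error of at most 1/2, where the cosine is still at least 1/2. One quarter is spent
    on missing the centre of the moving packet, one quarter on its dispersion, and all numerical
    constants below come from this budget. *)

(** * Oscillatory integrals over the unit interval *)

Section osc.
Context {R : realType}.
Implicit Types p q : R -> R.
Local Notation mu := (@lebesgue_measure R).

(* Continuity and derivatives on [0, 1] are two-sided, also at the endpoints. *)
Definition ucont p := forall e : R, 0 <= e <= 1 -> {for e, continuous p}.

Definition C1 p p1 := (forall e : R, 0 <= e <= 1 -> is_derive e 1 p (p1 e)) /\ ucont p1.

Definition C2 p p1 p2 := C1 p p1 /\ C1 p1 p2.

Lemma C1_ucont p p1 : C1 p p1 -> ucont p.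
Proof.
move=> [dp _] e e01; have [dpe _] := dp e e01.
by apply: differentiable_continuous; exact/derivable1_diffP.
Qed.

Lemma ucont_within p : ucont p -> {within `[0, 1], continuous p}.
Proof.
move=> cp; apply: continuous_in_subspaceT => e; rewrite inE /= in_itv /=; exact: cp.
Qed.

Lemma ucont_integrable p : ucont p -> mu.-integrable `[0, 1] (EFin \o p).
Proof.
move=> /ucont_within cp; apply: continuous_compact_integrable => //.
exact: segment_compact.
Qed.

Lemma ucont_bounded p : ucont p ->
  exists2 K, 0 <= K & forall e : R, 0 <= e <= 1 -> `|p e| <= K.
Proof.
move=> cp.
have cn : ucont (fun e => `|p e|).
  by move=> e e01; apply: continuous_comp; [exact: cp|exact: norm_continuous].
have [c _ hc] := EVT_max ler01 (ucont_within _ cn).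
by exists `|p c|.
Qed.

Lemma continuous_ucont p : continuous p -> ucont p.
Proof. by move=> cp e _; exact: cp. Qed.

Lemma ucontM p q : ucont p -> ucont q -> ucont (fun e => p e * q e).
Proof. by move=> cp cq e e01; apply: continuousM; [exact: cp|exact: cq]. Qed.

Lemma ucontD p q : ucont p -> ucont q -> ucont (fun e => p e + q e).
Proof. by move=> cp cq e e01; apply: continuousD; [exact: cp|exact: cq]. Qed.

Lemma ucontN p : ucont p -> ucont (fun e => - p e).
Proof. by move=> cp e e01; apply: continuousN; exact: cp. Qed.

Lemma ucont_comp p q : continuous q -> ucont p -> ucont (fun e => q (p e)).
Proof. by move=> cq cp e e01; apply: continuous_comp; [exact: cp|exact: cq]. Qed.

Lemma continuous_affine (x c : R) : continuous (fun e : R => x * e + c).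
Proof.
move=> e; apply: continuousD; last exact: cst_continuous.
by apply: continuousM; [exact: cst_continuous|exact: cvg_id].
Qed.

Lemma continuous_cos_affine (x c : R) : continuous (fun e : R => cos (x * e + c)).
Proof.
move=> e; apply: continuous_comp; first exact: continuous_affine.
exact: continuous_cos.
Qed.

Lemma is_derive_affine (x c e : R) : is_derive e 1 (fun e : R => x * e + c) x.
Proof.
by apply: is_derive_eq; rewrite /GRing.scale /=; ring.
Qed.

Lemma C1M p p1 q q1 : C1 p p1 -> C1 q q1 ->
  C1 (fun e => p e * q e) (fun e => p1 e * q e + p e * q1 e).
Proof.
move=> Cp Cq; have up := C1_ucont _ _ Cp; have uq := C1_ucont _ _ Cq.
case: Cp Cq => dp cp1 [dq cq1]; split=> [e e01|].
  have ? := dp e e01; have ? := dq e e01.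
  by apply: (is_derive_eq (is_deriveM _ _)); rewrite /GRing.scale /=; ring.
by apply: ucontD; apply: ucontM.
Qed.

Lemma C1D p p1 q q1 : C1 p p1 -> C1 q q1 ->
  C1 (fun e => p e + q e) (fun e => p1 e + q1 e).
Proof.
move=> [dp cp1] [dq cq1]; split=> [e e01|]; last exact: ucontD.
by have ? := dp e e01; have ? := dq e e01; exact: is_deriveD.
Qed.

Lemma C2M p p1 p2 q q1 q2 : C2 p p1 p2 -> C2 q q1 q2 ->
  C2 (fun e => p e * q e) (fun e => p1 e * q e + p e * q1 e)
     (fun e => (p2 e * q e + p1 e * q1 e) + (p1 e * q1 e + p e * q2 e)).
Proof. by move=> [? ?] [? ?]; split; [|apply: C1D]; exact: C1M. Qed.

Lemma C1_comp (f f1 : R -> R) p p1 :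
  (forall y : R, is_derive y 1 f (f1 y)) -> continuous f1 ->
  C1 p p1 -> C1 (fun e => f (p e)) (fun e => f1 (p e) * p1 e).
Proof.
move=> df cf1 Cp; have up := C1_ucont _ _ Cp; case: Cp => dp cp1.
split=> [e e01|]; last by apply: ucontM => //; exact: ucont_comp.
by have ? := dp e e01; have ? := df (p e); exact: is_derive1_comp.
Qed.

(** The derivatives are left existential: only their continuity, hence their boundedness on
    [[0, 1]], matters for the decay estimate. *)
Lemma C2_comp (f f1 f2 : R -> R) p p1 p2 :
  (forall y : R, is_derive y 1 f (f1 y)) -> (forall y : R, is_derive y 1 f1 (f2 y)) ->
  continuous f1 -> continuous f2 ->
  C2 p p1 p2 -> exists q1 q2, C2 (fun e => f (p e)) q1 q2.
Proof.
move=> df df1 cf1 cf2 [Cp Cp1]; eexists; eexists; split; first exact: C1_comp Cp.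
by apply: C1M Cp1; exact: C1_comp Cp.
Qed.

(** The free phase [c] covers cosine and sine at once and makes the family stable under integration
    by parts and under rotation by [cis], both of which only shift [c]. *)
Definition osc p x c : R := \int[mu]_(e in `[0, 1]) (p e * cos (x * e + c)).

Lemma ucont_osc p x c : ucont p -> ucont (fun e => p e * cos (x * e + c)).
Proof.
by move=> cp; apply: ucontM => //; apply: continuous_ucont; exact: continuous_cos_affine.
Qed.

Lemma mu01 : mu `[0, 1] = 1%E.
Proof. by rewrite lebesgue_measure_itv /= lte_fin ltr01 oppr0 adde0. Qed.

Lemma le_Rintegral01 p K : ucont p -> (forall e : R, 0 <= e <= 1 -> `|p e| <= K) ->
  `|\int[mu]_(e in `[0, 1]) p e| <= K.
Proof.
move=> cp pK.
apply: (le_trans (le_normr_Rintegral _ (ucont_integrable _ cp))) => //.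
have -> : K = \int[mu]_(e in `[0, 1]) K.
  by rewrite Rintegral_cst//= mu01 /= mulr1.
apply: le_Rintegral => //.
- by apply: (ucont_integrable (fun e => `|p e|)); apply: ucont_comp => //; exact: norm_continuous.
- by apply: (ucont_integrable (fun=> K)); apply: continuous_ucont; exact: cst_continuous.
Qed.

Lemma osc_bounded p K x c : ucont p -> (forall e : R, 0 <= e <= 1 -> `|p e| <= K) ->
  `|osc p x c| <= K.
Proof.
move=> cp pK; apply: le_Rintegral01; first exact: ucont_osc.
move=> e e01; rewrite normrM -[leRHS]mulr1 ler_pM// ?pK// ler_norml.
by rewrite cos_geN1 cos_le1.
Qed.

Lemma derivable_LR p p1 : C1 p p1 -> derivable_oo_LRcontinuous p 0 1.
Proof.
move=> Cp; have up := C1_ucont _ _ Cp; case: Cp => dp _; split.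
- move=> e e01; have [] // := dp e _.
  by move: e01; rewrite !in_itv /= => /andP[? ?]; rewrite !ltW.
- by apply: cvg_at_right_filter; apply: up; rewrite lexx ler01.
- by apply: cvg_at_left_filter; apply: up; rewrite lexx ler01.
Qed.

(** Integration by parts without boundary terms; the resulting [- sin] is a cosine advanced by
    [pi / 2]. *)
Lemma osc_ibp p p1 x c : C1 p p1 -> p 0 = 0 -> p 1 = 0 ->
  x * osc p x c = osc p1 x (c + pi / 2).
Proof.
move=> Cp p00 p10; pose G e := sin (x * e + c).
have CG : C1 G (fun e => cos (x * e + c) * x).
  apply: (C1_comp sin cos _ (fun=> x)); [exact: continuous_cos|].
  split; [by move=> e _; exact: is_derive_affine|].
  by apply: continuous_ucont; exact: cst_continuous.
have up1 := Cp.2; have up := C1_ucont _ _ Cp; have uG := C1_ucont _ _ CG.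
rewrite /osc -RintegralZl//; last exact: (ucont_integrable _ (ucont_osc _ x c up)).
transitivity (\int[mu]_(e in `[0, 1]) (p e * (cos (x * e + c) * x))).
  by apply: eq_Rintegral => e _; ring.
have oo e : e \in `]0, 1[%R -> 0 <= e <= 1.
  by rewrite !in_itv /= => /andP[? ?]; rewrite !ltW.
rewrite (@Rintegration_by_parts _ p G p1)//; last 6 first.
- exact: ucont_within.
- exact: derivable_LR Cp.
- by move=> e /oo e01; rewrite derive1E; apply: derive_val; exact: Cp.1.
- by apply: ucont_within; exact: CG.2.
- exact: derivable_LR CG.
- by move=> e /oo e01; rewrite derive1E; apply: derive_val; exact: CG.1.
rewrite p00 p10 !mul0r subrr sub0r -mulN1r -RintegralZl//; last first.
  by apply: (ucont_integrable (fun e => p1 e * G e)); exact: ucontM.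
by apply: eq_Rintegral => e _; rewrite addrA cosDpihalf /G; ring.
Qed.

(** The trivial bound controls the integral itself, two integrations by parts control [x ^ 2] times
    it; adding the two gives the denominator, with no singularity at [x = 0]. *)
Lemma osc_decay p p1 p2 K0 K2 x c : C2 p p1 p2 ->
  p 0 = 0 -> p 1 = 0 -> p1 0 = 0 -> p1 1 = 0 ->
  (forall e : R, 0 <= e <= 1 -> `|p e| <= K0) ->
  (forall e : R, 0 <= e <= 1 -> `|p2 e| <= K2) ->
  `|osc p x c| <= (K0 + K2) / (1 + x ^+ 2).
Proof.
move=> [Cp Cp1] p00 p10 p100 p110 pK0 pK2.
rewrite ler_pdivlMr; last by rewrite ltr_pwDl// sqr_ge0.
rewrite mulrDr mulr1 lerD//; first by apply: osc_bounded => //; exact: C1_ucont Cp.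
have -> : `|osc p x c| * x ^+ 2 = `|x * (x * osc p x c)|.
  by rewrite mulrA -expr2 normrM normrX mulrC real_normK// num_real.
rewrite (osc_ibp _ _ _ _ Cp)// (osc_ibp _ _ _ _ Cp1)//.
by apply: osc_bounded => //; exact: Cp1.2.
Qed.

Lemma oscD p x c d : ucont p ->
  osc p x (c + d) = cos d * osc p x c - sin d * osc p x (c - pi / 2).
Proof.
move=> up; have uo y := ucont_osc p x y up.
have io y := ucont_integrable _ (uo y).
rewrite /osc -RintegralZl// -RintegralZl// -RintegralB//.
- apply: eq_Rintegral => e _.
  by rewrite !addrA (cosD _ d) cosBpihalf; ring.
- apply: (ucont_integrable (fun e => cos d * (p e * cos (x * e + c)))).
  by apply: ucontM => //; apply: continuous_ucont; exact: cst_continuous.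
- apply: (ucont_integrable (fun e => sin d * (p e * cos (x * e + (c - pi / 2))))).
  by apply: ucontM => //; apply: continuous_ucont; exact: cst_continuous.
Qed.

End osc.

(** * The Fourier transform of the Abel weight *)

Section abel.
Context {R : realType}.
Local Notation mu := (@lebesgue_measure R).

Lemma cos1_ge0 (y : R) : 0 <= 1 + cos y.
Proof. by have := cos_geN1 y; lra. Qed.

Lemma continuous_expRN_norm (eps : R) : continuous (fun x : R => expR (- eps * `|x|)).
Proof.
move=> x; apply: (@continuous_comp _ _ _ (fun x : R => - eps * `|x|) expR); last exact: continuous_expR.
by apply: continuousM; [exact: cst_continuous|exact: norm_continuous].
Qed.

Lemma continuous_1Dcos (u : R) : continuous (fun x : R => 1 + cos (u * x)).
Proof.
move=> x; apply: cvgD; first exact: cvg_cst.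
apply: (@continuous_comp _ _ _ (fun x : R => u * x) cos); last exact: continuous_cos.
exact: mulrl_continuous.
Qed.

Let antideriv (eps u x : R) := - (expR (- eps * x) / eps) +
  expR (- eps * x) * (u * sin (u * x) - eps * cos (u * x)) / (eps ^+ 2 + u ^+ 2).

Let sq_gt0 (eps u : R) : 0 < eps -> 0 < eps ^+ 2 + u ^+ 2.
Proof. by move=> e0; rewrite ltr_pwDl ?sqr_ge0// exprn_gt0. Qed.

Let is_derive_antideriv (eps u x : R) : 0 < eps ->
  is_derive x 1 (antideriv eps u) (expR (- eps * x) * (1 + cos (u * x))).
Proof.
move=> e0; have := sq_gt0 eps u e0 => d0.
have dE : is_derive x 1 (fun x => expR (- eps * x)) (expR (- eps * x) * (- eps)).
  apply: (@is_derive1_comp R expR (fun x => - eps * x)).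
  by apply: is_derive_eq; rewrite /GRing.scale /=; ring.
have dl : is_derive x 1 (fun x => u * x) u.
  by apply: is_derive_eq; rewrite /GRing.scale /=; ring.
have dS : is_derive x 1 (fun x => sin (u * x)) (cos (u * x) * u).
  exact: (@is_derive1_comp R sin (fun x => u * x)).
have dC : is_derive x 1 (fun x => cos (u * x)) (- sin (u * x) * u).
  exact: (@is_derive1_comp R cos (fun x => u * x)).
rewrite /antideriv; apply: is_derive_eq; rewrite /GRing.scale /=; field.
by rewrite !gt_eqF.
Qed.

(* The summand 1 makes the integrand nonnegative, as the improper fundamental
   theorem of calculus requires; the case u = 0 is subtracted in abel_kernel. *)
Lemma abel_half (eps u : R) : 0 < eps ->
  (\int[mu]_(x in `[0%R, +oo[) (expR (- eps * x) * (1 + cos (u * x)))%:E =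
   (eps^-1 + eps / (eps ^+ 2 + u ^+ 2))%:E)%E.
Proof.
move=> e0; have d0 := sq_gt0 eps u e0.
have dF x := is_derive_antideriv eps u x e0.
have cF : continuous (antideriv eps u).
  move=> x; apply: differentiable_continuous; apply/derivable1_diffP.
  by have [] := dF x.
rewrite (@ge0_continuous_FTC2y _ _ (antideriv eps u) 0 0).
- rewrite -EFinB; congr EFin; rewrite /antideriv !mulr0 expR0 sin0 cos0; field.
  by rewrite !gt_eqF.
- move=> x _; by rewrite mulr_ge0 ?expR_ge0 ?cos1_ge0.
- apply: continuous_subspaceT => x; apply: cvgM.
    apply: (@continuous_comp _ _ _ (fun x : R => - eps * x) expR); last exact: continuous_expR.
    exact: mulrl_continuous.
  exact: continuous_1Dcos.
- have cvgE : (expR (- eps * x) @[x --> +oo%R] --> (0 : R))%classic.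
    have -> : (fun x => expR (- eps * x)) = (fun x => expR (- x)) \o (fun x => eps * x).
      by apply/funext => x /=; rewrite mulNr.
    have h : (eps * x @[x --> +oo%R] --> +oo%R)%classic by apply: gt0_cvgMry => //; exact: cvg_id.
    exact: (cvg_comp _ _ h (@cvgr_expR R)).
  pose K := eps^-1 + (`|u| + eps) / (eps ^+ 2 + u ^+ 2).
  have K0 (c : R) : (c * expR (- eps * x) @[x --> +oo%R] --> (0 : R))%classic.
    by rewrite -[X in _ --> X](mulr0 c); apply: cvgM => //; exact: cvg_cst.
  apply: (squeeze_cvgr _ (K0 (- K)) (K0 K)).
  apply: nearW => x; rewrite mulNr -ler_norml.
  have -> : antideriv eps u x = (- eps^-1 + (u * sin (u * x) - eps * cos (u * x)) /
      (eps ^+ 2 + u ^+ 2)) * expR (- eps * x) by rewrite /antideriv; ring.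
  rewrite normrM (ger0_norm (expR_ge0 _)) ler_wpM2r ?expR_ge0//.
  rewrite /K (le_trans (ler_normD _ _))// normrN gtr0_norm ?invr_gt0// lerD2l.
  have di : 0 <= (eps ^+ 2 + u ^+ 2)^-1 by rewrite invr_ge0 ltW.
  rewrite normrM (ger0_norm di) ler_wpM2r//.
  rewrite (le_trans (ler_normB _ _))// !normrM (gtr0_norm e0) lerD//.
    by rewrite ler_piMr// sin_max.
  by rewrite ler_piMr ?cos_max// ltW.
- by move=> x _; have [] := dF x.
- by apply: cvg_at_right_filter; exact: cF.
- by move=> x _; rewrite derive1E; apply: derive_val; exact: dF.
Qed.

Lemma abel_full (eps u : R) : 0 < eps ->
  (\int[mu]_x (expR (- eps * `|x|) * (1 + cos (u * x)))%:E =
   (2 * (eps^-1 + eps / (eps ^+ 2 + u ^+ 2)))%:E)%E.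
Proof.
move=> e0; rewrite ge0_symfun_integralT.
- rewrite EFinM -(abel_half _ u e0) set_itvcy; congr *%E.
  by apply: eq_integral => x; rewrite inE /= => x0; rewrite ger0_norm.
- by move=> x; rewrite mulr_ge0 ?expR_ge0 ?cos1_ge0.
- move=> x; apply: cvgM.
    exact: continuous_expRN_norm.
  exact: continuous_1Dcos.
- by move=> x /=; rewrite normrN mulrN cosN.
Qed.

Lemma integrable_expRN (eps : R) : 0 < eps ->
  mu.-integrable setT (fun x => (expR (- eps * `|x|))%:E).
Proof.
move=> e0.
have me : measurable_fun setT (fun x : R => expR (- eps * `|x|)).
  apply: continuous_measurable_fun => x.
  exact: continuous_expRN_norm.
apply/integrableP; split; first exact/measurable_EFinP.
have := abel_full eps 0 e0; under eq_integral do rewrite mul0r cos0.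
move=> h; apply: (@le_lt_trans _ _ (\int[mu]_x (expR (- eps * `|x|) * (1 + 1))%:E)%E).
  apply: ge0_le_integral => //=.
  - by apply/measurable_EFinP; apply: measurableT_comp.
  - by apply/measurable_EFinP; apply: measurable_funM.
  - move=> x _; rewrite lee_fin ger0_norm ?expR_ge0//.
    by rewrite ler_peMr ?expR_ge0// lerDl.
by rewrite h ltry.
Qed.

Lemma abel_kernel (eps u : R) : 0 < eps ->
  \int[mu]_x (expR (- eps * `|x|) * cos (u * x)) = 2 * eps / (eps ^+ 2 + u ^+ 2).
Proof.
move=> e0; have ie := integrable_expRN eps e0.
have mE : measurable_fun setT (fun x : R => expR (- eps * `|x|)).
  by apply/measurable_EFinP; case/integrableP : ie.
have mc : measurable_fun setT (fun x : R => cos (u * x)).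
  apply: continuous_measurable_fun => x.
  apply: continuous_comp; last exact: continuous_cos.
  exact: mulrl_continuous.
have ic : mu.-integrable setT (fun x => (expR (- eps * `|x|) * cos (u * x))%:E).
  apply: le_integrable ie => //.
    by apply/measurable_EFinP; exact: measurable_funM.
  by move=> x _; rewrite lee_fin normrM ler_piMr// cos_max.
have h := abel_full eps u e0; have h0 := abel_full eps 0 e0.
have : \int[mu]_x (expR (- eps * `|x|) * (1 + cos (u * x))) =
       \int[mu]_x (expR (- eps * `|x|)) + \int[mu]_x (expR (- eps * `|x|) * cos (u * x)).
  rewrite -RintegralD//; apply: eq_Rintegral => x _; ring.
rewrite {1}/Rintegral h /=.
have : \int[mu]_x (2 * expR (- eps * `|x|)) = 2 * \int[mu]_x (expR (- eps * `|x|)).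
  by rewrite RintegralZl.
(* Twice the weight is the integrand of [abel_full] at [u = 0], so its integral is known and can be
   subtracted. *)
rewrite {1}/Rintegral; under eq_integral.
  move=> x _; have -> : 2 * expR (- eps * `|x|) = expR (- eps * `|x|) * (1 + cos (0 * x)).
    by rewrite mul0r cos0; ring.
  over.
rewrite h0 /= => e1 e2.
have d0 := sq_gt0 eps u e0.
have {}e1 : \int[mu]_x expR (- eps * `|x|) = 2 / eps.
  apply: (mulfI (_ : 2 != 0)) => //; rewrite -e1; field.
  by rewrite gt_eqF.
move: e2; rewrite e1 => /esym/eqP; rewrite -subr_eq0 => /eqP e2.
apply/eqP; rewrite -subr_eq0 -e2; apply/eqP; field.
by rewrite !gt_eqF.
Qed.

End abel.

(** * Integrals of products over a product space *)

Section tensor.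
Context d1 d2 (T1 : measurableType d1) (T2 : measurableType d2) (R : realType).
Variables (m1 : {sigma_finite_measure set T1 -> \bar R}).
Variables (m2 : {sigma_finite_measure set T2 -> \bar R}).
Implicit Types (f : T1 -> R) (g : T2 -> R).

Lemma EFin_Rintegral d (T : measurableType d) (mu : {measure set T -> \bar R})
    (D : set T) (f : T -> R) :
  measurable D -> mu.-integrable D (EFin \o f) ->
  (\int[mu]_(x in D) (f x)%:E)%E = (\int[mu]_(x in D) f x)%:E.
Proof. by move=> mD fi; rewrite /Rintegral fineK//; exact: integrable_fin_num. Qed.

Lemma measurable_tensor f g : measurable_fun setT f -> measurable_fun setT g ->
  measurable_fun setT (fun z : T1 * T2 => f z.1 * g z.2).
Proof.
move=> mf mg; apply: measurable_funM.
  exact: (measurableT_comp mf measurable_fst).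
exact: (measurableT_comp mg measurable_snd).
Qed.

Lemma integrable_tensor f g :
  m1.-integrable setT (EFin \o f) -> m2.-integrable setT (EFin \o g) ->
  (m1 \x m2)%E.-integrable setT (fun z => (f z.1 * g z.2)%:E).
Proof.
move=> fi gi; have mf : measurable_fun setT f.
  by apply/measurable_EFinP; case/integrableP : fi.
have mg : measurable_fun setT g.
  by apply/measurable_EFinP; case/integrableP : gi.
apply/integrable12ltyP; first by apply/measurable_EFinP; exact: measurable_tensor.
have -> : (fun x => \int[m2]_y `|(f (x, y).1 * g (x, y).2)%:E|)%E =
    (fun x => `|(f x)%:E| * \int[m2]_y `|(g y)%:E|)%E.
  apply/funext => x /=; rewrite -ge0_integralZl//.
    by apply: eq_integral => y _; rewrite normrM.
  by apply/measurable_EFinP; exact: measurableT_comp.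
rewrite ge0_integralZr//=; last 2 first.
  by apply/measurable_EFinP; exact: measurableT_comp.
  by apply: integral_ge0 => ? _; rewrite lee_fin.
case/integrableP : fi => _ /= fy; case/integrableP : gi => _ /= gy.
by rewrite lte_mul_pinfty// ?integral_ge0// ge0_fin_numE// integral_ge0.
Qed.

Lemma Rintegral_tensor f g :
  m1.-integrable setT (EFin \o f) -> m2.-integrable setT (EFin \o g) ->
  (\int[(m1 \x m2)%E]_z (f z.1 * g z.2) =
   (\int[m1]_x f x) * (\int[m2]_y g y))%R.
Proof.
move=> fi gi; rewrite {1}/Rintegral -integral12_prod_meas1; last exact: integrable_tensor.
rewrite /fubini_F /=; under eq_integral => x _.
  rewrite (_ : (fun y => _) = (fun y => (f x)%:E * (g y)%:E)%E)//.
  rewrite integralZl// EFin_Rintegral//; over.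
rewrite integralZr//= EFin_Rintegral//.
Qed.

End tensor.

(** * Abel summation turns the inversion integral into a Poisson integral *)

Section osc_abel.
Context {R : realType}.
Implicit Types p : R -> R.
Local Notation mu := (@lebesgue_measure R).

Lemma measurable_continuous_comp d (T : measurableType d) (f : R -> R) (g : T -> R) :
  continuous f ->
  measurable_fun setT g -> measurable_fun setT (fun x => f (g x)).
Proof. by move=> cf mg; exact: (measurableT_comp (continuous_measurable_fun cf) mg). Qed.

(** The weight makes the double integral of [p e * cos (x * (e - s))] absolutely convergent, so
    Fubini applies; integrating in [x] first leaves [abel_kernel] at [u = e - s]. *)
Lemma osc_abel p (s eps : R) : ucont p -> 0 < eps ->
  \int[mu]_x (expR (- eps * `|x|) * osc p x (- (x * s))) =
  \int[mu]_(e in `[0, 1]) (p e * (2 * eps / (eps ^+ 2 + (e - s) ^+ 2))).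
Proof.
(* Extension by zero puts both variables on the whole line, as the product measure requires. *)
move=> cp e0; pose pp := p \_ `[0%R, 1%R].
have ppi : mu.-integrable setT (EFin \o pp).
  have /integrable_mkcond := ucont_integrable _ cp.
  by move=> /(_ (measurable_itv _)); rewrite restrict_EFin.
have Ei := integrable_expRN eps e0.
have mpp : measurable_fun setT pp.
  by apply/measurable_EFinP; case/integrableP : ppi.
have mE : measurable_fun setT (fun x : R => expR (- eps * `|x|)).
  by apply/measurable_EFinP; case/integrableP : Ei.
have osc_pp x c : osc p x c = \int[mu]_e (pp e * cos (x * e + c)).
  rewrite /osc Rintegral_mkcond; apply: eq_Rintegral => e _.
  by rewrite /pp !patchE; case: ifPn => // _; rewrite mul0r.
have mcos (c d : R) : measurable_fun setT (fun e : R => cos (c * e + d)).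
  by apply: continuous_measurable_fun; exact: continuous_cos_affine.
have ppci x c : mu.-integrable setT (fun e => (pp e * cos (x * e + c))%:E).
  apply: le_integrable ppi => //.
    by apply/measurable_EFinP; apply: measurable_funM => //; exact: mcos.
  by move=> e _; rewrite lee_fin normrM ler_piMr// cos_max.
pose f (z : R * R) := ((expR (- eps * `|z.1|) * pp z.2) * cos (z.1 * (z.2 - s)))%:E.
have fi : (mu \x mu)%E.-integrable setT f.
  apply: le_integrable (integrable_tensor _ _ _ _ _ _ _ _ _ Ei ppi) => //.
    apply/measurable_EFinP; apply: measurable_funM; first
      exact: (measurable_tensor _ _ _ _ _ (fun x : R => expR (- eps * `|x|)) pp).
    apply: measurable_continuous_comp; first exact: continuous_cos.
    apply: measurable_funM; first exact: measurable_fst.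
    apply: measurable_funB; first exact: measurable_snd.
    by [].
  by move=> z _; rewrite lee_fin normrM ler_piMr// cos_max.
have inner x : (\int[mu]_e f (x, e) = (expR (- eps * `|x|) * osc p x (- (x * s)))%:E)%E.
  have ppcx := ppci x (- (x * s)).
  rewrite EFinM osc_pp -EFin_Rintegral// -integralZl//; apply: eq_integral => e _.
  by rewrite /f -EFinM /= mulrA; congr ((_ * cos _)%:E); ring.
have outer e : (\int[mu]_x f (x, e) = (pp e * (2 * eps / (eps ^+ 2 + (e - s) ^+ 2)))%:E)%E.
  have Eci : mu.-integrable setT (fun x => (expR (- eps * `|x|) * cos ((e - s) * x))%:E).
    apply: le_integrable Ei => //.
      apply/measurable_EFinP; apply: measurable_funM => //.
      apply: measurable_continuous_comp; first exact: continuous_cos.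
      by apply: measurable_funM; [exact: measurable_cst|exact: measurable_id].
    by move=> x _; rewrite lee_fin normrM ler_piMr// cos_max.
  rewrite EFinM -abel_kernel// -EFin_Rintegral// -integralZl//; apply: eq_integral => x _.
  by rewrite /f -EFinM /= [x * _]mulrC; congr EFin; ring.
have h : (\int[mu]_x \int[mu]_e f (x, e) = \int[mu]_e \int[mu]_x f (x, e))%E := Fubini fi.
transitivity (fine (\int[mu]_x \int[mu]_e f (x, e))%E).
  by congr fine; apply: eq_integral => x _; rewrite inner.
rewrite h /Rintegral.
rewrite [in RHS]integral_mkcond; congr fine; apply: eq_integral => e _.
by rewrite outer /pp !patchE; case: ifPn => // _; rewrite mul0r.
Qed.

End osc_abel.

(** * Regularity and integrability of oscillatory integrals in [x] *)

Section inversion.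
Context {R : realType}.
Implicit Types p : R -> R.
Local Notation mu := (@lebesgue_measure R).

Lemma is_derive_lipschitz (f f1 : R -> R) (a b K : R) :
  (forall x, a <= x <= b -> is_derive x 1 f (f1 x)) ->
  (forall x, a <= x <= b -> `|f1 x| <= K) ->
  forall x y, a <= x <= b -> a <= y <= b -> `|f x - f y| <= K * `|x - y|.
Proof.
move=> df fK; suff h x y : a <= x <= b -> a <= y <= b -> x <= y -> `|f y - f x| <= K * `|y - x|.
  move=> x y xab yab; have [xy|/ltW yx] := leP x y; last exact: h.
  by rewrite distrC (distrC x); exact: h.
move=> /andP[ax xb] /andP[ay yb] xy.
have sub z : x <= z <= y -> a <= z <= b.
  by move=> /andP[xz zy]; rewrite (le_trans ax xz) (le_trans zy yb).
have [||c cxy ->] := @MVT_segment _ f f1 _ _ xy.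
- move=> z; rewrite in_itv /= => /andP[xz zy]; apply: df; apply: sub.
  by rewrite !ltW.
- apply: continuous_in_subspaceT => z; rewrite inE /= in_itv /= => zxy.
  apply: differentiable_continuous; apply/derivable1_diffP.
  by have [] := df z (sub _ zxy).
rewrite normrM ler_wpM2r// fK// sub//.
Qed.

Lemma cos_lipschitz (u v : R) : `|cos u - cos v| <= `|u - v|.
Proof.
rewrite -[leRHS]mul1r.
apply: (@is_derive_lipschitz cos (fun x => - sin x) (Num.min u v) (Num.max u v)).
- by move=> x _; rewrite normrN sin_max.
- by rewrite ge_min le_max lexx.
- by rewrite ge_min le_max lexx !orbT.
Qed.

Lemma osc_lipschitz p (K x y c d : R) : ucont p ->
  (forall e : R, 0 <= e <= 1 -> `|p e| <= K) ->
  `|osc p x c - osc p y d| <= K * (`|x - y| + `|c - d|).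
Proof.
move=> cp pK; have up z b := ucont_osc p z b cp.
have ip z b := ucont_integrable _ (up z b).
rewrite /osc -RintegralB//.
apply: (le_Rintegral01 (fun e => p e * cos (x * e + c) - p e * cos (y * e + d))).
  by apply: ucontD => //; apply: ucontN.
move=> e e01; rewrite -mulrBr normrM ler_pM ?pK//.
rewrite (le_trans (cos_lipschitz _ _))//.
have -> : x * e + c - (y * e + d) = (x - y) * e + (c - d) by ring.
rewrite (le_trans (ler_normD _ _))// lerD2r normrM ler_piMr//.
by case/andP: e01 => e0 e1; rewrite ger0_norm.
Qed.

Lemma continuous_osc p (al be : R) : ucont p ->
  continuous (fun x => osc p x (x * al + be)).
Proof.
move=> cp; have [K K0 pK] := ucont_bounded _ cp => x.
(* The Lipschitz constant may be 0; the added 1 allows dividing by it. *)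
have C0 : 0 < K * (1 + `|al|) + 1 by rewrite ltr_wpDl// mulr_ge0// addr_ge0// ler01.
apply/cvgrPdist_le => eps e0; apply/nbhs_ballP.
exists (eps / (K * (1 + `|al|) + 1)); first by rewrite /= divr_gt0.
move=> y /ltW; rewrite ler_pdivlMr// => xy; apply: le_trans xy.
apply: (le_trans (osc_lipschitz p K _ _ _ _ cp pK)).
have -> : x * al + be - (y * al + be) = (x - y) * al by ring.
rewrite normrM -[X in X + _]mulr1 -mulrDr mulrA mulrAC mulrC ler_wpM2l//.
by rewrite lerDl.
Qed.

Lemma integral_oneDsqrV : (\int[mu]_x ((1 + x ^+ 2)^-1)%:E = (pi)%:E)%E.
Proof.
have c : continuous (fun x : R => (1 + x ^+ 2)^-1).
  move=> x; apply: cvgV; first by rewrite gt_eqF// ltr_pwDl ?sqr_ge0.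
  by apply: cvgD; [exact: cvg_cst|exact: exprn_continuous].
rewrite ge0_symfun_integralT//.
- rewrite -set_itvcy (@ge0_continuous_FTC2y _ _ (@atan R) 0 (pi / 2)).
  + by rewrite atan0 -EFinB -EFinM; congr EFin; field.
  + by move=> x _; rewrite invr_ge0 addr_ge0 ?sqr_ge0.
  + exact: continuous_subspaceT.
  + exact: cvgy_atan.
  + by move=> x _; exact: derivable_atan.
  + by apply: cvg_at_right_filter; exact: continuous_atan.
  + by move=> x _; rewrite derive1_atan.
- by move=> x; rewrite invr_ge0 addr_ge0 ?sqr_ge0.
- by move=> x /=; rewrite sqrrN.
Qed.

Lemma integrable_oneDsqrV (K : R) : mu.-integrable setT (fun x => (K / (1 + x ^+ 2))%:E).
Proof.
have h : mu.-integrable setT (fun x => ((1 + x ^+ 2)^-1)%:E).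
  apply/integrableP; split.
    apply/measurable_EFinP; apply: continuous_measurable_fun => x.
    apply: cvgV; first by rewrite gt_eqF// ltr_pwDl ?sqr_ge0.
    by apply: cvgD; [exact: cvg_cst|exact: exprn_continuous].
  under eq_integral => x _.
    rewrite gee0_abs; last by rewrite lee_fin invr_ge0 addr_ge0 ?sqr_ge0.
    over.
  by rewrite integral_oneDsqrV ltry.
exact: (integrableZl measurableT K h).
Qed.

(** The vanishing of [p] and [p1] at both ends is exactly what removes the boundary terms from two
    integrations by parts. *)
Definition bump01 p := exists p1 p2,
  C2 p p1 p2 /\ [/\ p 0 = 0, p 1 = 0, p1 0 = 0 & p1 1 = 0].

Lemma bump01_ucont p : bump01 p -> ucont p.
Proof. by move=> [p1 [p2 [[Cp _] _]]]; exact: C1_ucont Cp. Qed.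

Lemma bump01_decay p : bump01 p ->
  exists K, forall x c, `|osc p x c| <= K / (1 + x ^+ 2).
Proof.
move=> [p1 [p2 [Cp [p00 p10 p100 p110]]]].
have [K0 _ pK0] := ucont_bounded _ (C1_ucont _ _ Cp.1).
have [K2 _ pK2] := ucont_bounded _ Cp.2.2.
by exists (K0 + K2) => x c; apply: osc_decay Cp _ _ _ _ _ _.
Qed.

Lemma integrable_osc p al be : bump01 p ->
  mu.-integrable setT (fun x => (osc p x (x * al + be))%:E).
Proof.
move=> bp; have [K pK] := bump01_decay p bp.
apply: le_integrable (integrable_oneDsqrV K) => //.
  apply/measurable_EFinP; apply: continuous_measurable_fun.
  exact: continuous_osc (bump01_ucont _ bp).
by move=> x _; rewrite lee_fin (le_trans (pK _ _))// ler_norm.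
Qed.

Lemma Rdominated_convergence d (T : measurableType d) (m : {measure set T -> \bar R})
    (D : set T) (f_ : nat -> T -> R) (f g : T -> R) : measurable D ->
  (forall n, measurable_fun D (f_ n)) -> measurable_fun D f ->
  (forall x, D x -> f_ n x @[n --> \oo] --> f x) ->
  m.-integrable D (EFin \o g) ->
  (forall n x, D x -> `|f_ n x| <= g x) ->
  \int[m]_(x in D) f_ n x @[n --> \oo] --> \int[m]_(x in D) f x.
Proof.
move=> mD mf_ mf f_f gi f_g.
have [|||||fi _] := @dominated_convergence _ _ _ m D mD
  (fun n => EFin \o f_ n) (EFin \o f) (EFin \o g).
- by move=> n; exact/measurable_EFinP.
- exact/measurable_EFinP.
- by apply: aeW => x Dx; apply: cvg_EFin; [exact: nearW|exact: f_f].
- exact: gi.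
- by apply: aeW => x n Dx; rewrite lee_fin f_g.
by rewrite (EFin_Rintegral _ _ _ _ _ _ mD fi) => /fine_cvg.
Qed.

End inversion.

(** * Fourier inversion for bumps *)

Section inversion_theorem.
Context {R : realType}.
Implicit Types p : R -> R.
Local Notation mu := (@lebesgue_measure R).

(** Bumps are given by formulas on the whole line, but [osc] sees only [[0, 1]]; this is the
    function that inversion recovers. *)
Definition ext0 p (s : R) := if 0 <= s <= 1 then p s else 0.

(** For [s] outside [[0, 1]] the comparison is with the endpoint on the side of [s], where [p]
    vanishes and which is no farther from [e] than [s] is. *)
Lemma ext0_lipschitz p : bump01 p -> exists2 K, 0 <= K &
  forall e s, 0 <= e <= 1 -> `|p e - ext0 p s| <= K * `|e - s|.
Proof.
move=> [p1 [p2 [[Cp Cp1] [p00 p10 _ _]]]].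
have [K K0 pK] := ucont_bounded _ Cp.2; exists K => // e s e01.
have L := @is_derive_lipschitz _ p p1 0 1 K Cp.1 pK.
rewrite /ext0; case: ifPn => [s01|]; first exact: L.
have [e0 e1] := andP e01.
rewrite negb_and -!ltNge => /orP[s0|s1].
  rewrite -p00; apply: (le_trans (L _ _ e01 _)); first by rewrite lexx ler01.
  by rewrite ler_wpM2l// subr0 ger0_norm// ger0_norm ?subr_ge0; lra.
rewrite -p10; apply: (le_trans (L _ _ e01 _)); first by rewrite lexx ler01.
by rewrite ler_wpM2l// ler0_norm ?ler0_norm ?subr_le0; lra.
Qed.

(** This is [2 * pi] times the Poisson kernel of the half-plane, centred at [s]. *)
Let kern (s eps e : R) := 2 * eps / (eps ^+ 2 + (e - s) ^+ 2).

Let den_gt0 (eps u : R) : 0 < eps -> 0 < eps ^+ 2 + u ^+ 2.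
Proof. by move=> e0; rewrite ltr_pwDl ?sqr_ge0// exprn_gt0. Qed.

Let continuous_kern s eps : 0 < eps -> continuous (kern s eps).
Proof.
move=> e0 x; apply: cvgM; first exact: cvg_cst.
apply: cvgV; first by rewrite gt_eqF// den_gt0.
apply: cvgD; first exact: cvg_cst.
apply: (@continuous_comp _ _ _ (fun e : R => e - s) (fun y => y ^+ 2)); last exact: exprn_continuous.
by apply: cvgB; [exact: cvg_id|exact: cvg_cst].
Qed.

Lemma integral_kern s eps : 0 < eps ->
  \int[mu]_(e in `[0, 1]) kern s eps e = 2 * (atan ((1 - s) / eps) + atan (s / eps)).
Proof.
move=> e0; pose F e := 2 * atan ((e - s) / eps).
have dF (x : R) : is_derive x 1 F (kern s eps x).
  have dl : is_derive x 1 (fun e : R => (e - s) / eps) eps^-1.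
    by apply: is_derive_eq; rewrite /GRing.scale /=; ring.
  have da : is_derive x 1 (fun e : R => atan ((e - s) / eps))
      ((1 + ((x - s) / eps) ^+ 2)^-1 * eps^-1).
    exact: (@is_derive1_comp R (@atan R) (fun e : R => (e - s) / eps)).
  rewrite /F; apply: is_derive_eq; rewrite /GRing.scale /= /kern; field.
  by rewrite !gt_eqF ?den_gt0.
rewrite /Rintegral (@continuous_FTC2 _ _ F)//; first 3 last.
- by move=> x _; rewrite derive1E; apply: derive_val.
- by rewrite -EFinB /= /F sub0r mulNr atanN; ring.
- by apply: continuous_subspaceT; exact: continuous_kern.
- apply: (derivable_LR _ (kern s eps)); split; first by move=> x _; exact: dF.
  by apply: continuous_ucont; exact: continuous_kern.
Qed.

Let eps_ n : R := n.+1%:R^-1.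

Let eps_gt0 n : 0 < eps_ n. Proof. by rewrite invr_gt0. Qed.

Let cvg_eps : eps_ n @[n --> \oo] --> 0. Proof. exact: cvg_harmonic. Qed.

Let cvg_atan_eps (c : R) : 0 < c -> atan (c / eps_ n) @[n --> \oo] --> pi / 2.
Proof.
move=> c0; have h0 : (n.+1%:R : R) @[n --> \oo] --> +oo%R.
  by have := @cvgr_idn R; rewrite -(cvg_shiftS (fun n => n%:R : R)).
have h : c * n.+1%:R @[n --> \oo] --> +oo%R.
  have g : c * x @[x --> +oo%R] --> +oo%R by apply: gt0_cvgMry => //; exact: cvg_id.
  exact: (cvg_comp _ _ h0 g).
under eq_fun do rewrite /eps_ invrK.
exact: (cvg_comp _ _ h (@cvgy_atan R)).
Qed.

(** The mass of the kernel on [[0, 1]] tends to [2 * pi] only for [s] in the open interval; at an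
    endpoint half of it is lost, and outside all of it, but there the factor [ext0 p s] is 0. *)
Let cvg_main p s : p 0 = 0 -> p 1 = 0 ->
  ext0 p s * \int[mu]_(e in `[0, 1]) kern s (eps_ n) e @[n --> \oo] --> 2 * pi * ext0 p s.
Proof.
move=> p00 p10; under eq_fun do rewrite integral_kern//.
have [[s0 s1]|h] := pselect (0 < s /\ s < 1).
  have -> : 2 * pi * ext0 p s = ext0 p s * (2 * (pi / 2 + pi / 2)) by field.
  apply: cvgM; first exact: cvg_cst.
  apply: cvgM; first exact: cvg_cst.
  by apply: cvgD; apply: cvg_atan_eps; rewrite ?subr_gt0.
have -> : ext0 p s = 0.
  rewrite /ext0; case: ifPn => // /andP[s0 s1].
  move: s0; rewrite le_eqVlt => /orP[/eqP<-//|s0].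
  move: s1; rewrite le_eqVlt => /orP[/eqP->//|s1].
  by exfalso; apply: h.
rewrite mulr0; under eq_fun do rewrite mul0r.
exact: cvg_cst.
Qed.

(** The kernel blows up at [e = s] as [eps] tends to 0, but the Lipschitz factor compensates for it
    and the constant [K] dominates the integrands. *)
Let cvg_rest p s : bump01 p ->
  \int[mu]_(e in `[0, 1]) ((p e - ext0 p s) * kern s (eps_ n) e) @[n --> \oo] --> 0.
Proof.
move=> bp; have [K K0 pK] := ext0_lipschitz p bp.
have cp := bump01_ucont _ bp.
have ucp n : ucont (fun e => (p e - ext0 p s) * kern s (eps_ n) e).
  apply: ucontM; last by apply: continuous_ucont; exact: continuous_kern.
  by apply: ucontD => //; apply: continuous_ucont; exact: cst_continuous.
have E0 : \int[mu]_(e in `[0, 1]) (cst 0 e : R) = 0 by rewrite Rintegral_cst// mul0r.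
rewrite -[X in _ --> X]E0.
apply: (@Rdominated_convergence _ _ _ mu _
  (fun n e => (p e - ext0 p s) * kern s (eps_ n) e) (cst 0) (cst K)).
- exact: measurable_itv.
- by move=> n; apply/measurable_EFinP; case/integrableP : (ucont_integrable _ (ucp n)).
- exact: measurable_cst.
- move=> e /=; rewrite in_itv /= => e01.
  (* Away from [s] the kernel is at most [2 * eps / (e - s) ^ 2], linear in [eps]; at [e = s] the
     first factor is already 0. *)
  pose C := `|p e - ext0 p s| * (2 / (e - s) ^+ 2).
  have h c : c * eps_ n @[n --> \oo] --> 0.
    by rewrite -(mulr0 c); apply: cvgM => //; exact: cvg_cst.
  apply: (squeeze_cvgr _ (h (- C)) (h C)); apply: nearW => n.
  rewrite mulNr -ler_norml normrM /C -mulrA.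
  have [es|es] := eqVneq e s.
    have z : p e - ext0 p s = 0.
      by apply/eqP; rewrite -normr_le0 (le_trans (pK e s e01))// es subrr normr0 mulr0.
    by rewrite z normr0 !mul0r.
  rewrite ler_wpM2l//; have d0 : 0 < (e - s) ^+ 2 by rewrite exprn_even_gt0//= subr_eq0.
  rewrite ger0_norm; last by rewrite /kern divr_ge0 ?ltW ?den_gt0// mulr_gt0.
  rewrite /kern mulrAC ler_pM2r// ler_pM2l// lef_pV2 ?posrE ?den_gt0//.
  by rewrite lerDr sqr_ge0.
- apply: (ucont_integrable (cst K)); apply: continuous_ucont; exact: cst_continuous.
- move=> n e /=; rewrite in_itv /= => e01.
  rewrite normrM (le_trans (ler_wpM2r _ (pK _ s e01)))//.
  have d0 := den_gt0 (eps_ n) (e - s) (eps_gt0 n).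
  have k0 : 0 <= kern s (eps_ n) e by rewrite /kern divr_ge0 ?(ltW d0)// ltW// mulr_gt0.
  rewrite -mulrA ler_piMr// (ger0_norm k0) /kern mulrA ler_pdivrMr// mul1r.
  (* What remains is that [2 * eps * |e - s|] is at most [eps ^ 2 + |e - s| ^ 2]. *)
  rewrite -(real_normK (num_real (e - s))) -subr_ge0.
  have -> : eps_ n ^+ 2 + `|e - s| ^+ 2 - `|e - s| * (2 * eps_ n) = (eps_ n - `|e - s|) ^+ 2 by ring.
  exact: sqr_ge0.
Qed.

(** The Abel means have two limits: the plain integral, by the decay of [osc] and dominated
    convergence, and the value of the bump, by concentration of the Poisson kernel. *)
Theorem osc_inversion p s : bump01 p -> \int[mu]_x osc p x (- (x * s)) = 2 * pi * ext0 p s.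
Proof.
move=> bp; have cp := bump01_ucont _ bp; have [K pK] := bump01_decay _ bp.
have io : mu.-integrable setT (fun x => (osc p x (- (x * s)))%:E).
  apply: eq_integrable (integrable_osc p (- s) 0 bp) => // x _.
  by rewrite addr0 mulrN.
have mo : measurable_fun setT (fun x => osc p x (- (x * s))).
  by apply/measurable_EFinP; case/integrableP : io.
have l1 : \int[mu]_x (expR (- eps_ n * `|x|) * osc p x (- (x * s))) @[n --> \oo] -->
    \int[mu]_x osc p x (- (x * s)).
  apply: (@Rdominated_convergence _ _ _ mu setT
    (fun n x => expR (- eps_ n * `|x|) * osc p x (- (x * s)))
    (fun x => osc p x (- (x * s))) (fun x => K / (1 + x ^+ 2))).
  - exact: measurableT.
  - move=> n; apply: measurable_funM => //.
    by apply: continuous_measurable_fun; exact: continuous_expRN_norm.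
  - exact: mo.
  - move=> x _; rewrite -[X in _ --> X]mul1r; apply: cvgM; last exact: cvg_cst.
    have h : - eps_ n * `|x| @[n --> \oo] --> - 0 * `|x|.
      by apply: cvgM; [exact: cvgN|exact: cvg_cst].
    rewrite oppr0 mul0r in h.
    by have := cvg_comp _ _ h (@continuous_expR R 0); rewrite expR0.
  - exact: integrable_oneDsqrV.
  - move=> n x _; rewrite normrM (le_trans _ (pK x (- (x * s))))// ler_piMl//.
    by rewrite ger0_norm ?expR_ge0// -expR0 ler_expR mulNr oppr_le0 mulr_ge0// ltW.
have l2 : \int[mu]_x (expR (- eps_ n * `|x|) * osc p x (- (x * s))) @[n --> \oo] -->
    2 * pi * ext0 p s.
  have [p1 [p2 [_ [p00 p10 _ _]]]] := bp.
  have E n : \int[mu]_x (expR (- eps_ n * `|x|) * osc p x (- (x * s))) =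
      \int[mu]_(e in `[0, 1]) ((p e - ext0 p s) * kern s (eps_ n) e) +
      ext0 p s * \int[mu]_(e in `[0, 1]) kern s (eps_ n) e.
    have uk := continuous_ucont _ (continuous_kern s _ (eps_gt0 n)).
    have uc : ucont (fun=> ext0 p s) by apply: continuous_ucont; exact: cst_continuous.
    rewrite -RintegralZl//; last exact: ucont_integrable.
    rewrite -RintegralD//.
    - by rewrite osc_abel//; apply: eq_Rintegral => e _; rewrite -/(kern _ _ _); ring.
    - apply: (ucont_integrable (fun e => (p e - ext0 p s) * kern s (eps_ n) e)).
      by apply: ucontM => //; apply: ucontD => //; exact: ucontN.
    - by apply: (ucont_integrable (fun e => ext0 p s * kern s (eps_ n) e)); exact: ucontM.
  under eq_fun do rewrite E.
  have h := cvgD (cvg_rest p s bp) (cvg_main p s p00 p10); rewrite add0r in h; exact: h.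
by apply: (cvg_unique _ l1 l2); exact: norm_hausdorff.
Qed.

End inversion_theorem.

(** * Inverse Fourier transforms of complex bumps at a carrier frequency *)

Section wave.
Context {R : realType}.
Implicit Types p q : R -> R.
Local Notation mu := (@lebesgue_measure R).

Lemma ge0_integral_reflection (f : R -> \bar R) : measurable_fun setT f ->
  (forall x, (0 <= f x)%E) -> (\int[mu]_x f x = \int[mu]_x f (- x)%R)%E.
Proof.
move=> mf f0.
transitivity (\int[mu]_(x in (-%R : _ -> measurableTypeR R) @^-1` setT) f (- x)%R)%E; last first.
  by rewrite preimage_setT.
rewrite -ge0_integral_pushforward//=.
by apply: eq_measure_integral => //= A mA AS; exact/esym/lebesgue_measureN.
Qed.

Lemma Rintegral_odd (f : R -> R) : measurable_fun setT f ->
  (forall x, f (- x) = - f x) -> \int[mu]_x f x = 0.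
Proof.
move=> mf fN; rewrite /Rintegral integralE.
have mfE : measurable_fun setT (EFin \o f) by exact/measurable_EFinP.
rewrite (ge0_integral_reflection ((EFin \o f)^\+)%E)//; last exact: measurable_funepos.
rewrite (_ : (\int[mu]_x _)%E = (\int[mu]_x ((EFin \o f)^\- x))%E); last first.
  by apply: eq_integral => x _; rewrite funeposE funenegE /= fN EFinN.
(* An infinite common value is harmless, as [fine] sends infinities to 0. *)
by set I := (\int[mu]_x _)%E; case: I => //= r; rewrite subrr.
Qed.

Lemma oscNpi p x c : ucont p -> osc p x (c - pi / 2 - pi / 2) = - osc p x c.
Proof.
move=> up; have io := ucont_integrable _ (ucont_osc p x c up).
rewrite /osc -[RHS]mulN1r -RintegralZl//; apply: eq_Rintegral => e _.
by rewrite !addrA cosBpihalf sinBpihalf mulN1r mulrN.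
Qed.

Lemma oscD_sin p x c d : ucont p ->
  osc p x (c + d - pi / 2) = cos d * osc p x (c - pi / 2) + sin d * osc p x c.
Proof.
move=> up; have -> : c + d - pi / 2 = c - pi / 2 + d by ring.
by rewrite oscD// oscNpi// mulrN opprK.
Qed.

Lemma integral_osc_shift p (M : R) : bump01 p ->
  \int[mu]_x osc p x (x * M) = 2 * pi * ext0 p (- M).
Proof.
move=> bp; rewrite -osc_inversion//; apply: eq_Rintegral => x _.
by rewrite mulrN opprK.
Qed.

(** With the phase [- pi / 2] the integrand is [p e * sin (x * (e + M))], which is odd in [x]. *)
Lemma integral_osc_shift_odd p (M : R) : bump01 p ->
  \int[mu]_x osc p x (x * M - pi / 2) = 0.
Proof.
move=> bp; have up := bump01_ucont _ bp; apply: Rintegral_odd.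
  by apply: continuous_measurable_fun; exact: continuous_osc.
move=> x; have io := ucont_integrable _ (ucont_osc p x (x * M - pi / 2) up).
rewrite /osc -[RHS]mulN1r -RintegralZl//; apply: eq_Rintegral => e _.
rewrite !addrA !cosBpihalf (_ : - x * e + - x * M = - (x * e + x * M)); last by ring.
by rewrite sinN mulrN mulN1r.
Qed.

(* The inverse Fourier transform of xi |-> (p + i q)(xi - M), p and q being
   supported in [0, 1]; the sine is written cos (_ - pi / 2). *)
Definition wave p q (M x : R) : R[i] :=
  ((2 * pi)^-1 * (osc p x (x * M) - osc q x (x * M - pi / 2))) +i*
  ((2 * pi)^-1 * (osc p x (x * M - pi / 2) + osc q x (x * M))).

Lemma cis_wave p q (M x d : R) : ucont p -> ucont q ->
  cis d * wave p q M x =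
  ((2 * pi)^-1 * (osc p x (x * M + d) - osc q x (x * M + d - pi / 2))) +i*
  ((2 * pi)^-1 * (osc p x (x * M + d - pi / 2) + osc q x (x * M + d))).
Proof.
move=> up uq; rewrite /cis /wave !oscD_sin// (oscD p _ (x * M) d)// (oscD q _ (x * M) d)//.
by apply/eqP; rewrite eq_complex /=; apply/andP; split; apply/eqP; ring.
Qed.

(** A modulation only moves the carrier. The Fourier transform of a wave at [xi] is therefore the
    plain integral of another wave, which [Rintegral_wave] evaluates. *)
Lemma cis_wave_shift p q (M x xi : R) : ucont p -> ucont q ->
  cis (- (xi * x)) * wave p q M x = wave p q (M - xi) x.
Proof.
move=> up uq; rewrite cis_wave// /wave.
by have -> : x * M - xi * x = x * (M - xi) by ring.
Qed.

Lemma integrable_wave p q (M : R) : bump01 p -> bump01 q ->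
  mu.-integrable setT (fun x => (complex.Re (wave p q M x))%:E) /\
  mu.-integrable setT (fun x => (complex.Im (wave p q M x))%:E).
Proof.
move=> bp bq; have i0 r : bump01 r -> mu.-integrable setT (fun x => (osc r x (x * M))%:E).
  move=> br; apply: eq_integrable (integrable_osc r M 0 br) => // x _.
  by rewrite addr0.
have i1 r (br : bump01 r) := integrable_osc r M (- (pi / 2)) br.
split.
  exact: (integrableZl measurableT (2 * pi)^-1 (integrableB measurableT (i0 _ bp) (i1 _ bq))).
exact: (integrableZl measurableT (2 * pi)^-1 (integrableD measurableT (i1 _ bp) (i0 _ bq))).
Qed.

Lemma Rintegral_wave p q (M : R) : bump01 p -> bump01 q ->
  (\int[mu]_x complex.Re (wave p q M x)) +i* (\int[mu]_x complex.Im (wave p q M x)) =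
  ext0 p (- M) +i* ext0 q (- M).
Proof.
move=> bp bq; have i0 r : bump01 r -> mu.-integrable setT (fun x => (osc r x (x * M))%:E).
  move=> br; apply: eq_integrable (integrable_osc r M 0 br) => // x _.
  by rewrite addr0.
have i1 r (br : bump01 r) := integrable_osc r M (- (pi / 2)) br.
have pi0 : 2 * pi != 0 :> R by rewrite gt_eqF// mulr_gt0// pi_gt0.
have iB := integrableB measurableT (i0 _ bp) (i1 _ bq).
have iD := integrableD measurableT (i1 _ bp) (i0 _ bq).
rewrite /wave /= RintegralZl//= RintegralZl//=.
rewrite RintegralB//; [|exact: i0|exact: i1].
rewrite RintegralD//; [|exact: i1|exact: i0].
by rewrite !integral_osc_shift// !integral_osc_shift_odd// subr0 add0r !mulKf.
Qed.

Lemma cabs_sqr (z : R[i]) : cabs z ^+ 2 = complex.Re z ^+ 2 + complex.Im z ^+ 2.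
Proof. by case: z => u v; rewrite /cabs /= sqr_sqrtr// addr_ge0 ?sqr_ge0. Qed.

Lemma cabs_ge0 (z : R[i]) : 0 <= cabs z.
Proof. by case: z => u v; exact: sqrtr_ge0. Qed.

Lemma cabsM (z w : R[i]) : cabs (z * w) = cabs z * cabs w.
Proof. exact: ComplexField.Normc.normcM. Qed.

Lemma cabs_cis (d : R) : cabs (cis d) = 1.
Proof. by rewrite /cabs /cis /= cos2Dsin2 sqrtr1. Qed.

Lemma Re_le_cabs (z : R[i]) : complex.Re z <= cabs z.
Proof.
apply: (le_trans (ler_norm _)); rewrite -ler_sqr ?nnegrE ?cabs_ge0//.
by rewrite cabs_sqr real_normK ?num_real// lerDl sqr_ge0.
Qed.

Lemma cabs_le (z : R[i]) : cabs z <= `|complex.Re z| + `|complex.Im z|.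
Proof.
rewrite -ler_sqr ?nnegrE ?cabs_ge0 ?addr_ge0//.
rewrite cabs_sqr sqrrD !real_normK ?num_real// addrAC lerDl.
by rewrite mulrn_wge0// mulr_ge0.
Qed.

(** [K] is chosen before [M]: the carrier sits in the phase, and [bump01_decay] is uniform in the
    phase. *)
Lemma wave_decay p q : bump01 p -> bump01 q -> exists2 K, 0 <= K &
  forall M x, cabs (wave p q M x) <= K / (1 + x ^+ 2).
Proof.
move=> bp bq; have [K1 pK1] := bump01_decay _ bp; have [K2 qK2] := bump01_decay _ bq.
have pi0 : 0 <= (2 * pi)^-1 :> R by rewrite invr_ge0 mulr_ge0// pi_ge0.
have d0 x : 0 < 1 + x ^+ 2 :> R by rewrite ltr_pwDl// sqr_ge0.
have K10 : 0 <= K1.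
  by have := le_trans (normr_ge0 _) (pK1 0 0); rewrite pmulr_lge0 ?invr_gt0.
have K20 : 0 <= K2.
  by have := le_trans (normr_ge0 _) (qK2 0 0); rewrite pmulr_lge0 ?invr_gt0.
exists ((2 * pi)^-1 * (K1 + K2) + (2 * pi)^-1 * (K1 + K2)).
  by rewrite addr_ge0// mulr_ge0// addr_ge0.
move=> M x; apply: (le_trans (cabs_le _)); rewrite mulrDl lerD//=.
- rewrite normrM (ger0_norm pi0) -mulrA; apply: ler_wpM2l => //; rewrite [X in _ <= X]mulrDl.
  exact: le_trans (ler_normB _ _) (lerD (pK1 _ _) (qK2 _ _)).
- rewrite normrM (ger0_norm pi0) -mulrA; apply: ler_wpM2l => //; rewrite [X in _ <= X]mulrDl.
  exact: le_trans (ler_normD _ _) (lerD (pK1 _ _) (qK2 _ _)).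
Qed.

Lemma cos_ge_half (y : R) : `|y| <= 2^-1 -> 2^-1 <= cos y.
Proof.
move=> y1; have := le_trans (cos_lipschitz 0 y) (_ : `|0 - y| <= 2^-1).
rewrite sub0r normrN cos0 => /(_ y1) /(le_trans (ler_norm _)); lra.
Qed.

Lemma wave_lower (B phi : R -> R) (M x theta : R) : ucont B -> ucont phi ->
  (forall e, 0 <= e <= 1 -> 0 <= B e) ->
  (forall e, 0 <= e <= 1 -> `|phi e + x * e - theta| <= 2^-1) ->
  (4 * pi)^-1 * \int[mu]_(e in `[0, 1]) B e <=
  cabs (wave (fun e => B e * cos (phi e)) (fun e => B e * sin (phi e)) M x).
Proof.
move=> uB up B0 hphi.
have -> : (4 * pi)^-1 = (2 * pi)^-1 * 2^-1 :> R by rewrite -invfM; congr (_^-1); ring.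
have uc : ucont (fun e => B e * cos (phi e)).
  by apply: ucontM => //; apply: ucont_comp => //; exact: continuous_cos.
have us : ucont (fun e => B e * sin (phi e)).
  by apply: ucontM => //; apply: ucont_comp => //; exact: continuous_sin.
have iB := ucont_integrable _ uB.
set w := wave _ _ _ _.
(* This rotation cancels the carrier and the reference phase; the real part becomes the integral of
   [B e * cos (phi e + x * e - theta)], and the half lost to the cosine turns [2 * pi] into
   [4 * pi]. *)
have -> : cabs w = cabs (cis (- theta - x * M) * w) by rewrite cabsM cabs_cis mul1r.
apply: le_trans (Re_le_cabs _); rewrite cis_wave//=.
have -> : x * M + (- theta - x * M) = - theta by ring.
have ic := ucont_integrable _ (ucont_osc _ x (- theta) uc).
have is_ := ucont_integrable _ (ucont_osc _ x (- theta - pi / 2) us).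
rewrite /osc -RintegralB//.
rewrite -mulrA ler_wpM2l ?invr_ge0 ?mulr_ge0 ?pi_ge0// -RintegralZl//.
apply: le_Rintegral => //.
- apply: (ucont_integrable (fun e => 2^-1 * B e)); apply: ucontM => //.
  by apply: continuous_ucont; exact: cst_continuous.
- apply: (ucont_integrable (fun e => B e * cos (phi e) * cos (x * e - theta) -
    B e * sin (phi e) * cos (x * e + (- theta - pi / 2)))).
  by apply: ucontD; [|apply: ucontN]; exact: ucont_osc.
move=> e /=; rewrite in_itv /= => e01.
have -> : B e * cos (phi e) * cos (x * e - theta) -
      B e * sin (phi e) * cos (x * e + (- theta - pi / 2))
    = cos (phi e + x * e - theta) * B e.
  by rewrite !addrA cosBpihalf -(addrA (phi e)) (cosD (phi e)); ring.
by rewrite ler_wpM2r ?B0// cos_ge_half// hphi.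
Qed.

End wave.

(** * One-dimensional packets under the flow *)

Section packet.
Context {R : realType}.
Local Notation mu := (@lebesgue_measure R).
Implicit Types t M a e x xi : R.

(** The bump is the square of this, so that it has double zeros at 0 and 1; multiplication by any
    C^2 function, such as the cosine of the phase, keeps them. *)
Definition hat_root (e : R) := e * (1 - e).
Definition hat (e : R) := hat_root e * hat_root e.

Lemma C2_hat_root : C2 hat_root (fun e => 1 - 2 * e) (fun=> - 2).
Proof.
split; split.
- by move=> e _; apply: is_derive_eq; rewrite /GRing.scale /=; ring.
- apply: continuous_ucont => e; apply: cvgB; first exact: cvg_cst.
  by apply: cvgM; [exact: cvg_cst|exact: cvg_id].
- by move=> e _; apply: is_derive_eq; rewrite /GRing.scale /=; ring.
- by apply: continuous_ucont; exact: cst_continuous.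
Qed.

Lemma ucont_hat : ucont hat.
Proof. by have u := C1_ucont _ _ C2_hat_root.1; exact: ucontM. Qed.

Lemma hat_ge0 e : 0 <= hat e.
Proof. by rewrite /hat -expr2 sqr_ge0. Qed.

Lemma hat_le1 e : 0 <= e <= 1 -> hat e <= 1.
Proof.
move=> /andP[e0 e1]; rewrite /hat /hat_root -[leRHS]mulr1.
have h : 0 <= e * (1 - e) <= 1 by nra.
by case/andP: h => h0 h1; rewrite ler_pM.
Qed.

Lemma bump01_hatM q q1 q2 : C2 q q1 q2 -> bump01 (fun e => hat e * q e).
Proof.
move=> Cq; have Cb := C2M _ _ _ _ _ _ C2_hat_root C2_hat_root.
eexists; eexists; split; first exact: C2M Cb Cq.
by rewrite /hat /hat_root; split => /=; ring.
Qed.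

(** The derivative in [e] stays in this family: the exponent drops by one and the old exponent is
    absorbed into [t]. *)
Definition powphase (t M a e : R) := t * (M + e) `^ a.

Lemma is_derive_powphase t M a e : 0 < M -> 0 <= e <= 1 ->
  is_derive e 1 (powphase t M a) (powphase (t * a) M (a - 1) e).
Proof.
move=> M0 /andP[e0 _].
have Me : 0 < M + e by rewrite ltr_pwDl.
have dp := is_derive1_powR a Me.
have dl : is_derive e 1 (fun e : R => M + e) 1.
  by apply: is_derive_eq; rewrite /GRing.scale /=; ring.
have dc : is_derive e 1 (fun e : R => (M + e) `^ a) (a * (M + e) `^ (a - 1) * 1).
  exact: (@is_derive1_comp R (fun x => x `^ a) (fun e : R => M + e)).
by rewrite /powphase; apply: is_derive_eq; rewrite /GRing.scale /=; ring.
Qed.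

Lemma ucont_powphase t M a : 0 < M -> ucont (powphase t M a).
Proof.
move=> M0 e e01; apply: differentiable_continuous; apply/derivable1_diffP.
by have [] := is_derive_powphase t M a e M0 e01.
Qed.

Lemma C2_powphase t M a : 0 < M ->
  C2 (powphase t M a) (powphase (t * a) M (a - 1)) (powphase (t * a * (a - 1)) M (a - 1 - 1)).
Proof.
move=> M0; split; (split; [by move=> e; exact: is_derive_powphase|exact: ucont_powphase]).
Qed.

(* The inverse Fourier transform of hat (xi - M) e^(i t xi^a). *)
Definition packet (t a M x : R) : R[i] :=
  wave (fun e => hat e * cos (powphase t M a e))
       (fun e => hat e * sin (powphase t M a e)) M x.

Lemma bump01_packet t a M : 0 < M ->
  bump01 (fun e => hat e * cos (powphase t M a e)) /\
  bump01 (fun e => hat e * sin (powphase t M a e)).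
Proof.
move=> M0; have C := C2_powphase t M a M0; split.
- have [|| q1 [q2 Cq]] := C2_comp cos (fun x => - sin x) (fun x => - cos x) _ _ _ _ _ _ _ C.
  + by move=> y; apply: cvgN; exact: continuous_sin.
  + by move=> y; apply: cvgN; exact: continuous_cos.
  exact: bump01_hatM Cq.
- have [|| q1 [q2 Cq]] := C2_comp sin cos (fun x => - sin x) _ _ _ _ _ _ _ C.
  + exact: continuous_cos.
  + by move=> y; apply: cvgN; exact: continuous_sin.
  exact: bump01_hatM Cq.
Qed.

Lemma bump01_hat : bump01 hat.
Proof.
have -> : hat = (fun e => hat e * 1) by apply/funext => e; rewrite mulr1.
apply: (bump01_hatM (fun=> 1) (fun=> 0) (fun=> 0)).
by split; split; (move=> e _; exact: is_derive_cst) ||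
  (apply: continuous_ucont; exact: cst_continuous).
Qed.

Lemma packet0 a M x : packet 0 a M x = wave hat (fun=> 0) M x.
Proof.
rewrite /packet; congr (wave _ _ _ _); apply/funext => e;
  by rewrite /powphase mul0r ?cos0 ?sin0 ?mulr1 ?mulr0.
Qed.

Definition hat_at (M xi : R) : R := ext0 hat (xi - M).

Lemma fourier_packet t a M xi : 0 < M ->
  (\int[mu]_x complex.Re (cis (- (xi * x)) * packet t a M x)) +i*
  (\int[mu]_x complex.Im (cis (- (xi * x)) * packet t a M x)) =
  cis (t * xi `^ a) * (hat_at M xi)%:C.
Proof.
move=> M0; have [bp bq] := bump01_packet t a M M0.
transitivity (ext0 (fun e => hat e * cos (powphase t M a e)) (- (M - xi)) +i*
  ext0 (fun e => hat e * sin (powphase t M a e)) (- (M - xi))).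
  rewrite -Rintegral_wave//; congr (_ +i* _); apply: eq_Rintegral => x _;
  by rewrite /packet cis_wave_shift//; exact: bump01_ucont.
rewrite opprB /hat_at /ext0; case: ifPn => _; last by rewrite mulr0.
rewrite /powphase (addrC M) subrK /cis.
by apply/eqP; rewrite eq_complex /=; apply/andP; split; apply/eqP; ring.
Qed.

Lemma packet_decay t a M : 0 < M ->
  exists2 K, 0 <= K & forall x, cabs (packet t a M x) <= K / (1 + x ^+ 2).
Proof.
move=> M0; have [bp bq] := bump01_packet t a M M0.
by have [K K0 h] := wave_decay _ _ bp bq; exists K => // x; exact: h.
Qed.

Lemma bump01_0 : bump01 (fun=> 0 : R).
Proof.
exists (fun=> 0), (fun=> 0); split => //.
by split; split; (move=> e _; exact: is_derive_cst) ||
  (apply: continuous_ucont; exact: cst_continuous).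
Qed.

(** At time 0 the amplitudes are [hat] and 0, which do not involve [M], so one constant serves all
    frequencies. At other times [packet_decay] lets the constant depend on everything; it only
    serves membership in L^1 and L^2. *)
Lemma packet0_decay : exists2 K : R, 0 <= K &
  forall a M x, cabs (packet 0 a M x) <= K / (1 + x ^+ 2).
Proof.
have [K K0 h] := wave_decay _ _ bump01_hat bump01_0.
by exists K => // a M x; rewrite packet0; exact: h.
Qed.

(* On the support, the phase differs from a constant by at most 1/2, so there is
   no cancellation in the integral. *)
Lemma packet_lower t a M x : 1 <= a -> 0 <= t -> 0 < M ->
  `|x + a * t * M `^ (a - 1)| <= 4^-1 ->
  a * t * ((M + 1) `^ (a - 1) - M `^ (a - 1)) <= 4^-1 ->
  (4 * pi)^-1 * \int[mu]_(e in `[0, 1]) hat e <= cabs (packet t a M x).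
Proof.
move=> a1 t0 M0 h1 h2.
apply: (@wave_lower _ _ _ _ _ (powphase t M a 0)).
- exact: ucont_hat.
- exact: ucont_powphase.
- by move=> e _; exact: hat_ge0.
move=> e /andP[e0 e1].
(* The reference phase is that of the left end [e = 0]; the mean value theorem writes the variation
   as the frequency derivative at some [c] times [e]. *)
have [c /andP[c0 ce] ec] : exists2 c, 0 <= c <= e &
    powphase t M a e - powphase t M a 0 = powphase (t * a) M (a - 1) c * e.
  have [||c + E] := @MVT_segment _ (powphase t M a) (powphase (t * a) M (a - 1)) 0 e e0.
  - move=> z; rewrite in_itv /= => /andP[z0 ze]; apply: is_derive_powphase => //.
    by rewrite (ltW z0) (le_trans (ltW ze)).
  - apply: continuous_in_subspaceT => z; rewrite inE /= in_itv /= => /andP[z0 ze].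
    by apply: ucont_powphase => //; rewrite z0 (le_trans ze).
  by rewrite in_itv /= => cc; exists c => //; rewrite E subr0.
(* The first summand is the distance to the moving centre, the second the dispersion; each may use
   1/4. *)
have -> : powphase t M a e + x * e - powphase t M a 0 =
   ((x + a * t * M `^ (a - 1)) + a * t * ((M + c) `^ (a - 1) - M `^ (a - 1))) * e.
  rewrite addrAC ec /powphase; ring.
have c1 : c <= 1 by exact: le_trans ce e1.
have mono u v : 0 <= u -> u <= v -> u `^ (a - 1) <= v `^ (a - 1).
  by move=> u0 uv; rewrite ge0_ler_powR ?subr_ge0// nnegrE// (le_trans u0).
have at0 : 0 <= a * t by rewrite mulr_ge0// (le_trans ler01).
have d0 : 0 <= a * t * ((M + c) `^ (a - 1) - M `^ (a - 1)).
  by apply: mulr_ge0 => //; rewrite subr_ge0 mono ?lerDl// ltW.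
have d1 : a * t * ((M + c) `^ (a - 1) - M `^ (a - 1)) <= 4^-1.
  apply: le_trans h2; rewrite ler_wpM2l// lerD2r mono ?lerD2l//.
  by rewrite addr_ge0 ?(ltW M0).
rewrite normrM (ger0_norm e0) -[leRHS]mulr1 ler_pM//.
apply: (le_trans (ler_normD _ _)); rewrite (ger0_norm d0).
have -> : 2^-1 = 4^-1 + 4^-1 :> R by field.
exact: lerD.
Qed.

Lemma integral_hat_gt0 : 0 < \int[mu]_(e in `[0, 1]) hat e.
Proof.
(* Explicit primitive of [e ^ 2 * (1 - e) ^ 2]; the integral is 1/30. *)
pose F (e : R) := e ^+ 3 / 3 - e ^+ 4 / 2 + e ^+ 5 / 5.
have dF (x : R) : is_derive x 1 F (hat x).
  by rewrite /F; apply: is_derive_eq; rewrite /GRing.scale /= /hat /hat_root; field.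
rewrite /Rintegral (@continuous_FTC2 _ _ F)//; first 3 last.
- by move=> x _; rewrite derive1E; apply: derive_val.
- by rewrite -EFinB /= /F; lra.
- by apply: ucont_within; exact: ucont_hat.
- apply: (derivable_LR _ hat); split; first by move=> x _; exact: dF.
  exact: ucont_hat.
Qed.

End packet.

(** * Complex tensor products on R^n *)

Section tensor_product.
Context {R : realType}.
Local Notation mu := (@lebesgue_measure R).
Local Notation lam n := (lebesgue_measure_n R n).

Definition cint1 (f : R -> R[i]) : R[i] :=
  (\int[mu]_x complex.Re (f x)) +i* (\int[mu]_x complex.Im (f x)).

Definition tensor n (F : 'I_n -> R -> R[i]) (x : n.-tuple R) : R[i] :=
  \prod_(i < n) F i (tnth x i).
Arguments tensor {n} F x.

(** The measure in dimension [n.+1] is by construction the image of the product measure under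
    [cons_pair]. Measurability of [f] itself comes back through the inverse map, head and tail. *)
Lemma integrable_cons n (f : n.+1.-tuple R -> R) :
  (mu \x lam n)%E.-integrable setT (fun z => (f (cons_pair z))%:E) ->
  (lam n.+1).-integrable setT (fun x => (f x)%:E) /\
  \int[lam n.+1]_x f x = \int[(mu \x lam n)%E]_z f (cons_pair z).
Proof.
move=> fi.
have mf : measurable_fun setT f.
  have ms : measurable_fun [set: n.+1.-tuple R]
      (fun x => (thead x, [tuple of behead x]) : R * n.-tuple R).
    by apply/measurable_fun_pair; [exact: measurable_tnth|exact: measurable_behead].
  have mc : measurable_fun setT (fun z : R * n.-tuple R => f (cons_pair z)).
    by apply/measurable_EFinP; case/integrableP : fi.
  have -> : f = (fun z => f (cons_pair z)) \o
      (fun x => (thead x, [tuple of behead x]) : R * n.-tuple R).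
    apply/funext => x /=; congr f; rewrite [LHS](tuple_eta x).
    exact/val_inj.
  exact: measurableT_comp mc ms.
have mfE : measurable_fun setT (fun x => (f x)%:E) by exact/measurable_EFinP.
have E : (\int[lam n.+1]_x (f x)%:E = \int[(mu \x lam n)%E]_z (f (cons_pair z))%:E)%E.
  rewrite /= /lebesgue_cons integral_pushforward//=.
  exact: measurable_cons_pair.
split; last by rewrite /Rintegral E.
apply/integrableP; split => //=.
rewrite /lebesgue_cons ge0_integral_pushforward//=; last 2 first.
- exact: measurable_cons_pair.
- by apply/measurable_EFinP; exact: measurableT_comp.
by case/integrableP : fi.
Qed.

Lemma tensor_cons n (F : 'I_n.+1 -> R -> R[i]) (z : R * n.-tuple R) :
  tensor F (cons_pair z) = F ord0 z.1 * tensor (fun i => F (lift ord0 i)) z.2.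
Proof.
rewrite /tensor big_ord_recl; congr (_ * _); apply: eq_bigr => i _.
by rewrite /cons_pair tnthS.
Qed.

Lemma tensor_integral n (F : 'I_n -> R -> R[i]) :
  (forall i, mu.-integrable setT (fun x => (complex.Re (F i x))%:E)) ->
  (forall i, mu.-integrable setT (fun x => (complex.Im (F i x))%:E)) ->
  [/\ (lam n).-integrable setT (fun x => (complex.Re (tensor F x))%:E),
      (lam n).-integrable setT (fun x => (complex.Im (tensor F x))%:E) &
      cintegral (tensor F) = \prod_(i < n) cint1 (F i)].
Proof.
elim: n F => [|n IHn] F iR iI.
  (* Dimension 0: the measure is the unit mass at the empty tuple, so the constant 1 integrates to
     the empty product. *)
  have E : tensor F = fun=> 1 by apply/funext => x; rewrite /tensor big_ord0.
  have ic (c : R) : (lam 0).-integrable setT (fun=> c%:E).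
    apply/integrableP; split; first exact: measurable_cst.
    by rewrite integral_dirac//= diracT mul1e ltry.
  rewrite E /cintegral big_ord0; split; [exact: ic|exact: ic|].
  rewrite !Rintegral_cst//; set c := fine _.
  have -> : c = 1 by rewrite /c /= /dirac indicT.
  rewrite !mulr1.
  by apply/eqP; rewrite eq_complex /= !eqxx.
have [hR hI hE] := IHn _ (fun i => iR (lift ord0 i)) (fun i => iI (lift ord0 i)).
set G := tensor (fun i => F (lift ord0 i)) in hR hI hE.
(* The complex product is expanded into four real tensors, to which Fubini applies one by one. *)
have RR := integrable_tensor _ _ _ _ _ mu (lam n) _ _ (iR ord0) hR.
have II := integrable_tensor _ _ _ _ _ mu (lam n) _ _ (iI ord0) hI.
have RI := integrable_tensor _ _ _ _ _ mu (lam n) _ _ (iR ord0) hI.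
have IR := integrable_tensor _ _ _ _ _ mu (lam n) _ _ (iI ord0) hR.
have ER z : complex.Re (tensor F (cons_pair z)) =
    complex.Re (F ord0 z.1) * complex.Re (G z.2) - complex.Im (F ord0 z.1) * complex.Im (G z.2).
  by rewrite tensor_cons -/G; case: (F _ _) => ? ?; case: (G _).
have EI z : complex.Im (tensor F (cons_pair z)) =
    complex.Re (F ord0 z.1) * complex.Im (G z.2) + complex.Im (F ord0 z.1) * complex.Re (G z.2).
  by rewrite tensor_cons -/G; case: (F _ _) => ? ?; case: (G _).
have iER : (mu \x lam n)%E.-integrable setT (fun z => (complex.Re (tensor F (cons_pair z)))%:E).
  by apply: eq_integrable (integrableB measurableT RR II) => // z _; rewrite ER.
have iEI : (mu \x lam n)%E.-integrable setT (fun z => (complex.Im (tensor F (cons_pair z)))%:E).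
  by apply: eq_integrable (integrableD measurableT RI IR) => // z _; rewrite EI.
have [jR eR] := @integrable_cons n (fun x => complex.Re (tensor F x)) iER.
have [jI eI] := @integrable_cons n (fun x => complex.Im (tensor F x)) iEI.
split=> //.
rewrite /cintegral eR eI big_ord_recl -hE /cintegral /cint1.
under eq_Rintegral => z _ do rewrite ER.
under [X in _ +i* X]eq_Rintegral => z _ do rewrite EI.
have tE := Rintegral_tensor _ _ _ _ _ mu (lam n).
rewrite RintegralB// RintegralD//.
by congr ((_ - _) +i* (_ + _)); apply: tE => //; [exact: iR|exact: iI|exact: iR|exact: iI].
Qed.

End tensor_product.

Arguments tensor {R n} F x.

(** * Norms and Fourier transforms of tensors of decaying functions *)

Section decaying.
Context {R : realType}.
Local Notation mu := (@lebesgue_measure R).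
Local Notation lam n := (lebesgue_measure_n R n).

Definition decaying (K : R) (f : R -> R[i]) :=
  [/\ measurable_fun setT (fun x => complex.Re (f x)),
      measurable_fun setT (fun x => complex.Im (f x)) &
      forall x, cabs (f x) <= K / (1 + x ^+ 2)].

Lemma cabsE (z : R[i]) : cabs z = Num.sqrt (complex.Re z ^+ 2 + complex.Im z ^+ 2).
Proof. by case: z. Qed.

Lemma normRe_le_cabs (z : R[i]) : `|complex.Re z| <= cabs z.
Proof.
rewrite -ler_sqr ?nnegrE ?cabs_ge0//.
by rewrite cabs_sqr real_normK ?num_real// lerDl sqr_ge0.
Qed.

Lemma normIm_le_cabs (z : R[i]) : `|complex.Im z| <= cabs z.
Proof.
rewrite -ler_sqr ?nnegrE ?cabs_ge0//.
by rewrite cabs_sqr real_normK ?num_real// lerDr sqr_ge0.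
Qed.

Lemma measurable_cabs d (T : measurableType d) (f : T -> R[i]) :
  measurable_fun setT (fun x => complex.Re (f x)) ->
  measurable_fun setT (fun x => complex.Im (f x)) ->
  measurable_fun setT (fun x => cabs (f x)).
Proof.
move=> mR mI; under eq_fun do rewrite cabsE.
apply: (measurable_continuous_comp _ _ (@Num.sqrt R)); first exact: sqrt_continuous.
by apply: measurable_funD; exact: measurable_funX.
Qed.

Lemma decaying_integrable K f : decaying K f ->
  [/\ mu.-integrable setT (fun x => (complex.Re (f x))%:E),
      mu.-integrable setT (fun x => (complex.Im (f x))%:E) &
      mu.-integrable setT (fun x => (cabs (f x))%:E)].
Proof.
move=> [mR mI fK]; have iK := integrable_oneDsqrV K.
split; apply: le_integrable iK => //.
- exact/measurable_EFinP.
- by move=> x _; rewrite lee_fin (le_trans (normRe_le_cabs _))// (le_trans (fK _))// ler_norm.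
- exact/measurable_EFinP.
- by move=> x _; rewrite lee_fin (le_trans (normIm_le_cabs _))// (le_trans (fK _))// ler_norm.
- by apply/measurable_EFinP; exact: measurable_cabs.
- by move=> x _; rewrite lee_fin ger0_norm ?cabs_ge0// (le_trans (fK _))// ler_norm.
Qed.

(** As [1 + x ^ 2] is at least 1, the square of its inverse is below its inverse, whose integral is
    [pi]. The bound depends on [f] only through [K]. *)
Lemma decaying_sqr K f : 0 <= K -> decaying K f ->
  mu.-integrable setT (fun x => (cabs (f x) ^+ 2)%:E) /\
  \int[mu]_x (cabs (f x) ^+ 2) <= K ^+ 2 * pi.
Proof.
move=> K0 [mR mI fK]; have iK := integrable_oneDsqrV (K ^+ 2).
have h x : cabs (f x) ^+ 2 <= K ^+ 2 / (1 + x ^+ 2).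
  have x1 : 1 <= 1 + x ^+ 2 by rewrite lerDl sqr_ge0.
  have x0 : 0 < 1 + x ^+ 2 by exact: lt_le_trans ltr01 x1.
  apply: (@le_trans _ _ ((K / (1 + x ^+ 2)) ^+ 2)).
    by rewrite ler_sqr ?nnegrE ?cabs_ge0// divr_ge0// ltW.
  rewrite expr_div_n ler_wpM2l ?sqr_ge0// lef_pV2 ?posrE ?exprn_gt0//.
  by rewrite expr2 ler_peMl// ltW.
have i2 : mu.-integrable setT (fun x => (cabs (f x) ^+ 2)%:E).
  apply: le_integrable iK => //.
    by apply/measurable_EFinP; apply: measurable_funX; exact: measurable_cabs.
  by move=> x _; rewrite lee_fin ger0_norm ?sqr_ge0// (le_trans (h _))// ler_norm.
split=> //; have -> : K ^+ 2 * pi = \int[mu]_x (K ^+ 2 / (1 + x ^+ 2)).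
  rewrite RintegralZl//; first by rewrite /Rintegral integral_oneDsqrV.
  by apply: eq_integrable (integrable_oneDsqrV 1) => // x _; rewrite mul1r.
by apply: le_Rintegral.
Qed.

Lemma tensor_real n (h : 'I_n -> R -> R) :
  (forall i, mu.-integrable setT (fun x => (h i x)%:E)) ->
  (lam n).-integrable setT (fun x => (\prod_(i < n) h i (tnth x i))%:E) /\
  \int[lam n]_x (\prod_(i < n) h i (tnth x i)) = \prod_(i < n) \int[mu]_x h i x.
Proof.
move=> hi.
have i0 : mu.-integrable setT (fun=> 0%:E) by exact: integrable0.
have [||iR _ E] := @tensor_integral R n (fun i x => (h i x)%:C).
- by move=> i; exact: hi.
- by move=> i; exact: i0.
have TE x : tensor (fun i x => (h i x)%:C) x = (\prod_(i < n) h i (tnth x i))%:C.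
  by rewrite /tensor rmorph_prod.
split; first by apply: eq_integrable iR => // x _; rewrite TE.
have := congr1 (@complex.Re R) E; rewrite /cintegral /=.
under eq_Rintegral => x _ do rewrite TE /=.
move=> ->; rewrite (eq_bigr (fun i => (\int[mu]_x h i x)%:C)); last first.
  move=> i _; rewrite /cint1 /=; congr (_ +i* _).
  by rewrite Rintegral_cst// mul0r.
by rewrite -rmorph_prod.
Qed.

Lemma cabs_tensor n (F : 'I_n -> R -> R[i]) x :
  cabs (tensor F x) = \prod_(i < n) cabs (F i (tnth x i)).
Proof.
rewrite /tensor; elim/big_rec2: _ => [|i y1 y2 _ <-]; last exact: cabsM.
exact: ComplexField.Normc.normc1.
Qed.

Lemma cnorm1E n (f : n.-tuple R -> R[i]) :
  cnorm 1 f = (\int[lam n]_x (cabs (f x))%:E)%E.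
Proof.
rewrite /cnorm Lnorm1; apply: eq_integral => x _.
by rewrite gee0_abs// lee_fin cabs_ge0.
Qed.

Lemma cnorm2E n (f : n.-tuple R -> R[i]) :
  cnorm 2%:E f = ((\int[lam n]_x (cabs (f x) ^+ 2)%:E) `^ 2^-1)%E.
Proof.
rewrite /cnorm unlock /=; congr (_ `^ _)%E; apply: eq_integral => x _.
by rewrite ger0_norm ?cabs_ge0// powR_mulrn ?cabs_ge0.
Qed.

Lemma cnorm2_tensor n (K : 'I_n -> R) (F : 'I_n -> R -> R[i]) : (forall i, 0 <= K i) ->
  (forall i, decaying (K i) (F i)) ->
  (cnorm 2%:E (tensor F) <= ((\prod_(i < n) (K i ^+ 2 * pi)) `^ 2^-1)%:E)%E.
Proof.
move=> K0 dF; have [ii E] := @tensor_real n (fun i x => cabs (F i x) ^+ 2)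
  (fun i => (decaying_sqr _ _ (K0 i) (dF i)).1).
rewrite cnorm2E; under eq_integral => x _ do rewrite cabs_tensor -prodrXl.
rewrite EFin_Rintegral// E poweR_EFin lee_fin ge0_ler_powR//.
- rewrite nnegrE prodr_ge0// => i _; apply: Rintegral_ge0 => x _; exact: sqr_ge0.
- by rewrite nnegrE prodr_ge0// => i _; rewrite mulr_ge0 ?sqr_ge0 ?pi_ge0.
apply: ler_prod => i _; rewrite (decaying_sqr _ _ (K0 i) (dF i)).2 andbT.
by apply: Rintegral_ge0 => x _; exact: sqr_ge0.
Qed.

Lemma Lp_tensor n (K : 'I_n -> R) (F : 'I_n -> R -> R[i]) : (forall i, 0 <= K i) ->
  (forall i, decaying (K i) (F i)) -> Lp 1 (tensor F) /\ Lp 2%:E (tensor F).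
Proof.
move=> K0 dF.
have [|| iR iI _] := @tensor_integral R n F.
- by move=> i; have [] := decaying_integrable _ _ (dF i).
- by move=> i; have [] := decaying_integrable _ _ (dF i).
have mR : measurable_fun setT (fun x => complex.Re (tensor F x)).
  by apply/measurable_EFinP; case/integrableP : iR.
have mI : measurable_fun setT (fun x => complex.Im (tensor F x)).
  by apply/measurable_EFinP; case/integrableP : iI.
split; split=> //.
  have [|ii _] := @tensor_real n (fun i x => cabs (F i x)).
    by move=> i; have [] := decaying_integrable _ _ (dF i).
  rewrite cnorm1E; under eq_integral => x _ do rewrite cabs_tensor.
  by rewrite EFin_Rintegral// ltry.
by apply: le_lt_trans (cnorm2_tensor n K F K0 dF) _; rewrite ltry.
Qed.

Lemma cis_sum n (t : 'I_n -> R) : cis (\sum_(i < n) t i) = \prod_(i < n) cis (t i).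
Proof.
elim/big_rec2: _ => [|i y1 y2 _ <-]; first by rewrite /cis cos0 sin0.
rewrite /cis cosD sinD; apply/eqP; rewrite eq_complex /=.
by apply/andP; split => //; apply/eqP; ring.
Qed.

Lemma decaying_cis K (xi : R) f : decaying K f ->
  decaying K (fun x => cis (- (xi * x)) * f x).
Proof.
move=> [mR mI fK]; have ml : measurable_fun setT (fun x : R => - (xi * x)).
  by apply: continuous_measurable_fun => x; apply: cvgN; exact: mulrl_continuous.
have mc : measurable_fun setT (fun x : R => cos (- (xi * x))).
  by apply: measurable_continuous_comp ml; exact: continuous_cos.
have ms : measurable_fun setT (fun x : R => sin (- (xi * x))).
  by apply: measurable_continuous_comp ml; exact: continuous_sin.
split.
- rewrite (_ : (fun x => _) = (fun x => cos (- (xi * x)) * complex.Re (f x) -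
     sin (- (xi * x)) * complex.Im (f x))).
    by apply: measurable_funB; exact: measurable_funM.
  by apply/funext => x; case: (f x).
- rewrite (_ : (fun x => _) = (fun x => cos (- (xi * x)) * complex.Im (f x) +
     sin (- (xi * x)) * complex.Re (f x))).
    by apply: measurable_funD; exact: measurable_funM.
  by apply/funext => x; case: (f x).
- by move=> x; rewrite cabsM cabs_cis mul1r.
Qed.

(** The character of a sum of coordinate phases is itself a tensor, which merges with [F]. *)
Lemma fourier_tensor n (K : 'I_n -> R) (F : 'I_n -> R -> R[i]) (xi : n.-tuple R) :
  (forall i, decaying (K i) (F i)) ->
  fourier (tensor F) xi = \prod_(i < n) cint1 (fun x => cis (- (tnth xi i * x)) * F i x).
Proof.
move=> dF; rewrite /fourier.
have -> : (fun x => cis (- dotp xi x) * tensor F x) =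
    tensor (fun i x => cis (- (tnth xi i * x)) * F i x).
  by apply/funext => x; rewrite /dotp -sumrN cis_sum /tensor -big_split.
have [||_ _ //] := @tensor_integral R n (fun i x => cis (- (tnth xi i * x)) * F i x).
- by move=> i; have [] := decaying_integrable _ _ (decaying_cis _ (tnth xi i) _ (dF i)).
- by move=> i; have [] := decaying_integrable _ _ (decaying_cis _ (tnth xi i) _ (dF i)).
Qed.

Lemma cnorm2_0 n (f : n.-tuple R -> R[i]) : (forall x, f x = 0) -> cnorm 2%:E f = 0%E.
Proof.
move=> f0; rewrite cnorm2E; under eq_integral => x _.
  by rewrite f0 (_ : cabs 0 = 0) ?expr0n//; [over|exact: ComplexField.Normc.normc0].
by rewrite integral0 poweR0r// invr_eq0 pnatr_eq0.
Qed.

(** The constant sequence [f] serves as the approximation. *)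
Lemma fourierL2_of_fourier n (f F : n.-tuple R -> R[i]) : Lp 1 f -> Lp 2%:E f -> Lp 2%:E F ->
  (forall xi, fourier f xi = F xi) -> fourierL2 f F.
Proof.
move=> f1 f2 F2 fF; split=> //; exists (fun=> f); split => //.
  rewrite (_ : (fun k => _) = (fun=> 0%E)); first exact: cvg_cst.
  by apply/funext => k; rewrite cnorm2_0// => x; rewrite subrr.
rewrite (_ : (fun k => _) = (fun=> 0%E)); first exact: cvg_cst.
by apply/funext => k; rewrite cnorm2_0// => xi; rewrite fF subrr.
Qed.

End decaying.

(** * Tensors of packets solve the evolution equation *)

Section packet_propagator.
Context {R : realType}.
Local Notation mu := (@lebesgue_measure R).
Implicit Types t a xi : R.

Definition symbol t a (M xi : R) : R[i] := cis (t * xi `^ a) * (hat_at M xi)%:C.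

Lemma measurable_packet t a (M : R) : 0 < M ->
  measurable_fun setT (fun x => complex.Re (packet t a M x)) /\
  measurable_fun setT (fun x => complex.Im (packet t a M x)).
Proof.
move=> M0; have [bp bq] := bump01_packet t a M M0.
have [h1 h2] := integrable_wave _ _ M bp bq.
by split; apply/measurable_EFinP; [case/integrableP : h1|case/integrableP : h2].
Qed.

Lemma decaying_packet t a (M : R) : 0 < M ->
  exists2 K, 0 <= K & decaying K (packet t a M).
Proof.
move=> M0; have [K K0 h] := packet_decay t a M M0; exists K => //.
by have [? ?] := measurable_packet t a M M0.
Qed.

Lemma decaying_packet0 : exists2 K : R, 0 <= K &
  forall a (M : R), 0 < M -> decaying K (packet 0 a M).
Proof.
have [K K0 h] := @packet0_decay R; exists K => // a M M0.
by have [? ?] := measurable_packet 0 a M M0.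
Qed.

Lemma hat_at_ge0 (M xi : R) : 0 <= hat_at M xi.
Proof. by rewrite /hat_at /ext0; case: ifP => // _; exact: hat_ge0. Qed.

Lemma measurable_hat_at (M : R) : measurable_fun setT (hat_at M).
Proof.
have mh : measurable_fun setT (ext0 (@hat R)).
  have -> : ext0 (@hat R) = (fun s => hat s * \1_(`[0, 1] : set R) s).
    apply/funext => s; rewrite /ext0 indicE mem_setE in_itv /=.
    by case: ifP => _; rewrite ?mulr1 ?mulr0.
  have mr : measurable_fun setT (@hat_root R).
    by apply: measurable_funM => //; apply: measurable_funB.
  apply: measurable_funM; first exact: measurable_funM.
  exact: measurable_indic.
rewrite /hat_at; apply: (measurableT_comp mh).
by apply: measurable_funB; [exact: measurable_id|exact: measurable_cst].
Qed.

Lemma decaying_symbol t a (M : R) : 0 < M -> exists2 K, 0 <= K & decaying K (symbol t a M).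
Proof.
(* The symbol has modulus at most 1 and lives on [[M, M + 1]], where this is the maximum of
   [1 + xi ^ 2]. *)
move=> M0; exists (1 + (M + 1) ^+ 2); first by rewrite addr_ge0 ?sqr_ge0.
have mp : measurable_fun setT (fun xi : R => t * xi `^ a).
  by apply: measurable_funM; [exact: measurable_cst|exact: measurable_powR].
have mh := measurable_hat_at M.
split.
- rewrite (_ : (fun x => _) = (fun x => cos (t * x `^ a) * hat_at M x)).
    apply: measurable_funM => //; apply: measurable_continuous_comp mp; exact: continuous_cos.
  by apply/funext => x; rewrite /symbol /=; ring.
- rewrite (_ : (fun x => _) = (fun x => sin (t * x `^ a) * hat_at M x)).
    apply: measurable_funM => //; apply: measurable_continuous_comp mp; exact: continuous_sin.
  by apply/funext => x; rewrite /symbol /=; ring.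
move=> x; rewrite /symbol cabsM cabs_cis mul1r.
have -> : cabs (hat_at M x)%:C = hat_at M x.
  by rewrite cabsE /= expr0n /= addr0 sqrtr_sqr ger0_norm// hat_at_ge0.
have x0 : 0 < 1 + x ^+ 2 by rewrite ltr_pwDl ?sqr_ge0.
rewrite ler_pdivlMr// /hat_at /ext0; case: ifPn => [x01|_]; last first.
  by rewrite mul0r addr_ge0 ?sqr_ge0.
have h1 := hat_le1 _ x01; have h0 := hat_ge0 (x - M).
apply: (@le_trans _ _ (1 * (1 + x ^+ 2))).
  by rewrite ler_wpM2r// ltW.
case/andP: x01 => x1 x2; rewrite mul1r lerD2l ler_sqr ?nnegrE; nra.
Qed.

Lemma cint1_packet t a (M xi : R) : 0 < M ->
  cint1 (fun x => cis (- (xi * x)) * packet t a M x) = symbol t a M xi.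
Proof. exact: fourier_packet. Qed.

Lemma fourierL2_packet n t a (M : 'I_n -> R) : (forall i, 0 < M i) ->
  fourierL2 (tensor (fun i => packet t a (M i))) (tensor (fun i => symbol t a (M i))).
Proof.
move=> M0.
have /choice[K hK] : forall i, exists K, 0 <= K /\ decaying K (packet t a (M i)).
  by move=> i; have [K] := decaying_packet t a (M i) (M0 i); exists K.
have /choice[L hL] : forall i, exists K, 0 <= K /\ decaying K (symbol t a (M i)).
  by move=> i; have [K' ? ?] := decaying_symbol t a (M i) (M0 i); exists K'.
have [l1 l2] := Lp_tensor n K _ (fun i => (hK i).1) (fun i => (hK i).2).
have [_ L2] := Lp_tensor n L _ (fun i => (hL i).1) (fun i => (hL i).2).
apply: fourierL2_of_fourier => // xi.
rewrite (fourier_tensor n K _ xi (fun i => (hK i).2)).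
by apply: eq_bigr => i _; exact: cint1_packet.
Qed.

(** In these two cases the symbol splits over the coordinates, so tensors of one-dimensional
    solutions are solutions. Positive coordinates let the real power replace the power of the
    modulus. *)
Lemma enorm_powR n a (xi : n.-tuple R) : n = 1%N \/ a = 2 -> (forall i, 0 < tnth xi i) ->
  enorm xi `^ a = \sum_(i < n) tnth xi i `^ a.
Proof.
move=> [n1|->] xi0; rewrite /enorm.
  subst n; rewrite !big_ord_recl !big_ord0 !addr0 sqrtr_sqr ger0_norm// ltW//.
rewrite powR_mulrn ?sqrtr_ge0// sqr_sqrtr ?sumr_ge0//; last by move=> i _; exact: sqr_ge0.
by apply: eq_bigr => i _; rewrite powR_mulrn// ltW.
Qed.

Lemma symbol_evolution n t a (M : 'I_n -> R) (xi : n.-tuple R) :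
  n = 1%N \/ a = 2 -> (forall i, 0 < M i) ->
  cis (t * enorm xi `^ a) * tensor (fun i => symbol 0 a (M i)) xi =
  tensor (fun i => symbol t a (M i)) xi.
Proof.
move=> na M0; have cis0 : cis 0 = 1 :> R[i] by rewrite /cis cos0 sin0.
have [xi0|] := pselect (forall i, 0 < tnth xi i).
  rewrite enorm_powR// mulr_sumr cis_sum /tensor -big_split; apply: eq_bigr => i _.
  by rewrite /= /symbol mul0r cis0 mul1r.
(* A coordinate that is not positive lies outside the support [[M i, M i + 1]], and both sides
   vanish. *)
move=> /existsNP[i /negP]; rewrite -leNgt => xi0.
have h0 s : symbol s a (M i) (tnth xi i) = 0.
  rewrite /symbol /hat_at /ext0 ifF ?mulr0//.
  by apply/negbTE; rewrite negb_and -ltNge subr_lt0 (le_lt_trans xi0).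
have z s : tensor (fun i => symbol s a (M i)) xi = 0.
  by rewrite /tensor (bigD1 i)//= h0 mul0r.
by rewrite !z mulr0.
Qed.

Lemma propagator_packet n t a (M : 'I_n -> R) : n = 1%N \/ a = 2 -> (forall i, 0 < M i) ->
  propagator a t (tensor (fun i => packet 0 a (M i))) (tensor (fun i => packet t a (M i))).
Proof.
move=> na M0; exists (tensor (fun i => symbol 0 a (M i))); first exact: fourierL2_packet.
rewrite (_ : (fun xi : n.-tuple R => _) = tensor (fun i => symbol t a (M i))).
  exact: fourierL2_packet.
by apply/funext => xi; exact: symbol_evolution.
Qed.

End packet_propagator.

(** * Choice of the frequency and of the time *)

Section timing.
Context {R : realType}.
Implicit Types a x L M t : R.

(** The speed condition makes [s = W / T] at least [16 * L] for all [T] up to [L]. The last one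
    bounds the dispersion, because [t * W] stays below [L] at the times used. *)
Lemma large_frequency a L : 1 < a -> 1 <= L -> exists M : R,
  [/\ 1 <= M, 16 * L ^+ 2 <= a * M `^ (a - 1) &
      L * (((M + 1) / M) `^ (a - 1) - 1) <= 4^-1].
Proof.
move=> a1 L1; have a0 : 0 < a - 1 by rewrite subr_gt0.
have L0 : 0 < L by exact: lt_le_trans ltr01 L1.
pose e := ln (1 + (4 * L)^-1).
have e0 : 0 < e by rewrite ln_gt0// ltrDl invr_gt0 mulr_gt0.
(* One summand per requirement. The third gives [(a - 1) / M <= e], so that [(1 + 1 / M)] to the
   power [a - 1] is at most [expR e = 1 + 1 / (4 * L)]. *)
pose M := 1 + (16 * L ^+ 2) `^ (a - 1)^-1 + (a - 1) / e.
have p0 := powR_ge0 (16 * L ^+ 2) (a - 1)^-1.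
have q0 : 0 < (a - 1) / e by rewrite divr_gt0.
have M1 : 1 <= M by rewrite /M -addrA lerDl addr_ge0// ltW.
have M0 : 0 < M by exact: lt_le_trans ltr01 M1.
exists M; split => //.
- have h : 16 * L ^+ 2 <= M `^ (a - 1).
    have -> : 16 * L ^+ 2 = ((16 * L ^+ 2) `^ (a - 1)^-1) `^ (a - 1).
      by rewrite -powRrM mulVf ?gt_eqF// powRr1// mulr_ge0// sqr_ge0.
    rewrite ge0_ler_powR ?nnegrE ?(ltW a0) ?(ltW M0)// /M; lra.
  by rewrite (le_trans h)// ler_peMl ?powR_ge0// ltW.
have -> : (M + 1) / M = 1 + M^-1 by rewrite mulrDl divff ?gt_eqF// mul1r.
have h : (1 + M^-1) `^ (a - 1) <= 1 + (4 * L)^-1.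
  rewrite /powR gt_eqF ?addr_gt0 ?invr_gt0//.
  rewrite -[leRHS]lnK ?posrE ?addr_gt0 ?invr_gt0 ?mulr_gt0// ler_expR -/e.
  have le1 : ln (1 + M^-1) <= M^-1.
    rewrite -ler_expR lnK ?posrE ?addr_gt0 ?invr_gt0//; exact: expR_ge1Dx.
  apply: (@le_trans _ _ ((a - 1) * M^-1)); first by rewrite ler_wpM2l// ltW.
  rewrite ler_pdivrMr// -ler_pdivrMl// mulrC /M; lra.
rewrite -ler_pdivlMl// lerBlDl (le_trans h)//.
by rewrite invfM mulrC.
Qed.

(* k is the integer just above e^s, s = W / T, where T = - x and
   W = a M^(a-1): then log k exceeds s by at most e^(-s). *)
Lemma good_time a L M x : 1 < a -> 1 <= L -> 1 <= M ->
  16 * L ^+ 2 <= a * M `^ (a - 1) ->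
  L * (((M + 1) / M) `^ (a - 1) - 1) <= 4^-1 ->
  - L <= x <= - 1 ->
  exists2 k, (2 <= k)%N &
    [/\ 0 <= (ln k%:R)^-1 :> R, (ln k%:R)^-1 <= 16^-1 :> R,
        `|x + a * (ln k%:R)^-1 * M `^ (a - 1)| <= 4^-1 &
        a * (ln k%:R)^-1 * ((M + 1) `^ (a - 1) - M `^ (a - 1)) <= 4^-1].
Proof.
move=> a1 L1 M1 hW hM /andP[xL x1].
pose T := - x; have xT : x = - T by rewrite opprK.
have T1 : 1 <= T by rewrite /T; lra.
have TL : T <= L by rewrite /T; lra.
have T0 : 0 < T by lra.
have L0 : 0 < L by lra.
have M0 : 0 < M by lra.
pose W := a * M `^ (a - 1).
have W0 : 0 < W by rewrite (lt_le_trans _ hW)// mulr_gt0// exprn_gt0.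
pose s := W / T.
have s16 : 16 * L <= s.
  rewrite /s ler_pdivlMr//; apply: le_trans hW.
  by rewrite -mulrA ler_wpM2l// expr2 ler_wpM2l// ltW.
have s0 : 0 < s by rewrite divr_gt0.
pose k := (Num.truncn (expR s)).+1.
have e0 : 0 <= expR s by exact: expR_ge0.
have k1 : expR s < k%:R by exact: truncnS_gt.
have k2 : k%:R <= expR s + 1.
  by rewrite /k -natr1 lerD2r truncn_le.
have k0 : 0 < k%:R :> R by exact: le_lt_trans k1.
exists k.
  rewrite /k ltnS -(ler_nat R); apply: contraLR isT; rewrite -ltNge => h.
  exfalso; move: h; rewrite ltr_nat ltnS leqn0 => /eqP h.
  have : 1 <= expR s by rewrite -expR0 ler_expR ltW.
  by move: k1; rewrite /k h; lra.
set l := ln k%:R.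
have ls : s < l by rewrite -ltr_expR lnK.
have ls2 : l <= s + expR (- s).
  rewrite -ler_expR lnK// expRD (le_trans k2)//.
  apply: (@le_trans _ _ (expR s * (1 + expR (- s)))).
    by rewrite mulrDr mulr1 -expRD subrr expR0.
  by rewrite ler_wpM2l// expR_ge1Dx.
have l0 : 0 < l by exact: lt_trans ls.
have es : expR (- s) <= s^-1.
  rewrite expRN lef_pV2 ?posrE ?expR_gt0//.
  by apply: le_trans (expR_ge1Dx s); rewrite lerDr.
have l_inv : l^-1 <= s^-1 by rewrite lef_pV2 ?posrE// ltW.
have l16 : l^-1 <= (16 * L)^-1.
  by apply: (le_trans l_inv); rewrite lef_pV2 ?posrE// mulr_gt0.
have WsT : W = s * T by rewrite /s divfK// gt_eqF.
split.
- by rewrite invr_ge0 ltW.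
- apply: (le_trans l16); rewrite lef_pV2 ?posrE ?mulr_gt0//; lra.
- rewrite mulrAC -/W WsT xT.
  (* The miss at time [1 / l]. Here [T <= L], [l - s <= expR (- s) <= 1 / s <= 1 / 16] and
     [1 / l <= 1 / (16 * L)], so it is at most 1/256. *)
  have -> : - T + s * T * l^-1 = - (T * ((l - s) * l^-1)).
    by field; rewrite gt_eqF.
  have ls0 : 0 <= (l - s) * l^-1 by rewrite mulr_ge0 ?invr_ge0 ?subr_ge0 ?ltW.
  rewrite normrN ger0_norm; last by rewrite mulr_ge0// ltW.
  have b1 : (l - s) * l^-1 <= s^-1 * l^-1.
    rewrite ler_wpM2r ?invr_ge0 ?(ltW l0)//; lra.
  have sV : s^-1 <= 16^-1.
    rewrite lef_pV2 ?posrE//; lra.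
  have b2 : s^-1 * l^-1 <= 16^-1 * (16 * L)^-1.
    by rewrite ler_pM// ?invr_ge0 ?(ltW s0) ?(ltW l0).
  apply: (@le_trans _ _ (L * (16^-1 * (16 * L)^-1))).
    by rewrite ler_pM// ?(ltW T0)// (le_trans b1).
  have -> : L * (16^-1 * (16 * L)^-1) = 256^-1.
    by field; rewrite gt_eqF.
  lra.
- have -> : a * l^-1 * ((M + 1) `^ (a - 1) - M `^ (a - 1)) =
     W * l^-1 * (((M + 1) / M) `^ (a - 1) - 1).
    rewrite powRM ?invr_ge0 ?(ltW M0) ?addr_ge0//; [|lra].
    have -> : M^-1 `^ (a - 1) = (M `^ (a - 1))^-1.
      by rewrite -powR_inv1 ?(ltW M0)// -powRrM mulN1r powRN.
    have X0 : M `^ (a - 1) != 0 by rewrite gt_eqF// powR_gt0.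
    by rewrite /W; field; rewrite X0 gt_eqF.
  apply: le_trans hM; rewrite ler_wpM2r//.
    have p1 : 1 `^ (a - 1) = 1 :> R by rewrite powR1.
    rewrite subr_ge0 -[leLHS]p1 ge0_ler_powR ?nnegrE ?divr_ge0//; try lra.
    rewrite ler_pdivlMr//; lra.
  (* The factor [W / l] is at most [L], since [W = s * T] with [s < l] and [T <= L]. *)
  rewrite WsT ler_pdivrMr//; apply: (le_trans _ (ler_wpM2l (ltW L0) (ltW ls))).
  by rewrite mulrC ler_wpM2r// ltW.
Qed.

End timing.

(** * Lower bound for the maximal function on a long box *)

Section lower_bound.
Context {R : realType}.
Local Notation mu := (@lebesgue_measure R).
Local Notation lam n := (lebesgue_measure_n R n).

Definition packet_floor : R := (4 * pi)^-1 * \int[mu]_(e in `[0, 1]) hat e.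

Lemma packet_floor_gt0 : 0 < packet_floor.
Proof.
by rewrite /packet_floor mulr_gt0 ?integral_hat_gt0// invr_gt0 mulr_gt0// pi_gt0.
Qed.

Definition frequencies (m : nat) (M : R) (i : 'I_m.+1) : R := if i == ord0 then M else 1.

(** The other factors have frequency 1 and, with [a = 2], velocity -2. Up to time 1/16, which
    [good_time] guarantees, they move by at most 1/8; together with the half-width 1/8 this stays
    within 1/4. *)
Definition box (m : nat) (L : R) (i : 'I_m.+1) : set R :=
  if i == ord0 then `[(- L)%R, (- 1)%R]%classic else `[(- 8^-1)%R, 8^-1%R]%classic.

Lemma measurable_box m L i : measurable (@box m L i).
Proof. by rewrite /box; case: ifP => _; exact: measurable_itv. Qed.

Lemma lebesgue_measure_box m (L : R) : 1 <= L ->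
  lam m.+1 [set x | forall i, @box m L i (tnth x i)] = ((L - 1) * (4^-1) ^+ m)%:E.
Proof.
move=> L1; rewrite lebesgue_measure_nE; last by move=> i; exact: measurable_box.
rewrite big_ord_recl /box eqxx lebesgue_measure_itv /= lte_fin.
have -> : ((if (- L < - 1)%R then (- 1)%:E - (- L)%:E else 0) = (L - 1)%:E)%E.
  case: ifPn => [_|]; first by rewrite -EFinB; congr EFin; ring.
  (* For [L = 1] the first side is a single point and the length formula takes its other branch. *)
  by rewrite -leNgt lerN2 => L1'; have -> : L = 1 by [lra]; rewrite subrr.
rewrite (eq_bigr (fun=> (4^-1)%:E)); last first.
  move=> i _; rewrite lebesgue_measure_itv /= lte_fin.
  have -> : - 8^-1 < 8^-1 :> R by lra.
  by rewrite -EFinB; congr EFin; lra.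
rewrite EFinM; congr (_ * _)%E; elim: (m) => [|k IHk]; first by rewrite big_ord0.
by rewrite big_ord_recl IHk exprS.
Qed.

Lemma tensor_packet_lower m a (L M : R) (x : m.+1.-tuple R) :
  m = 0%N \/ a = 2 -> 1 < a -> 1 <= L -> 1 <= M -> 16 * L ^+ 2 <= a * M `^ (a - 1) ->
  L * (((M + 1) / M) `^ (a - 1) - 1) <= 4^-1 ->
  (forall i, @box m L i (tnth x i)) ->
  exists2 k, (2 <= k)%N &
    packet_floor ^+ m.+1 <=
    cabs (tensor (fun i => packet (ln k%:R)^-1 a (@frequencies m M i)) x).
Proof.
move=> ma a1 L1 M1 h1 h2 hx.
have := hx ord0; rewrite /box eqxx /= in_itv /= => x0.
have [k k2 [t0 t16 b1 b2]] := good_time _ _ _ _ a1 L1 M1 h1 h2 x0.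
exists k => //; rewrite cabs_tensor -[X in _ ^+ X]card_ord -prodr_const.
have c0 := ltW packet_floor_gt0.
apply: ler_prod => i _; rewrite c0 /=.
have a1' := ltW a1.
have [->|i0] := eqVneq i ord0.
  rewrite /frequencies eqxx; apply: packet_lower => //; exact: lt_le_trans ltr01 M1.
case: ma => [m0|a2]; first by subst m; rewrite (ord1 i) eqxx in i0.
rewrite /frequencies (negbTE i0); apply: packet_lower => //; subst a.
  have := hx i; rewrite /box (negbTE i0) /= in_itv /= => /andP[xl xu].
  by rewrite powR1 mulr1 ler_norml; apply/andP; split; lra.
have -> : 2 - 1 = 1 :> R by lra.
rewrite !powRr1//; lra.
Qed.

End lower_bound.

(** * Comparison of the norms and the contradiction *)

Section conclusion.
Context {R : realType}.
Local Notation lam n := (lebesgue_measure_n R n).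

(** Chebyshev's inequality, in the squared form that matches the measure of a box. *)
Lemma Lnorm2_ge_box n (s : n.-tuple R -> \bar R) (A : set (n.-tuple R)) (c D : R) :
  measurable A -> measurable_fun setT s -> 0 <= c -> 0 <= D ->
  (forall x, A x -> (c%:E <= s x)%E) -> ('N[lam n]_2%:E [s] <= D%:E)%E ->
  ((c ^+ 2)%:E * lam n A <= (D ^+ 2)%:E)%E.
Proof.
move=> mA ms c0 D0 hA sD.
have two0 : (2 : R) != 0 by rewrite pnatr_eq0.
have h : ('N[lam n]_2%:E [s] `^ 2 <= (D ^+ 2)%:E)%E.
  rewrite -(powR_mulrn 2 D0) -poweR_EFin; apply: gt0_ler_poweR => //.
  - by rewrite in_itv /= Lnorm_ge0 leey.
  - by rewrite in_itv /= lee_fin D0 leey.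
move: h; rewrite poweR_Lnorm// => h; apply: le_trans h.
have -> : ((c ^+ 2)%:E * lam n A = \int[lam n]_x ((c ^+ 2)%:E * (\1_A x)%:E))%E.
  rewrite ge0_integralZl ?integral_indic ?setIT ?lee_fin ?sqr_ge0//.
  by apply/measurable_EFinP; exact: measurable_indic.
apply: ge0_le_integral => //.
- by move=> x _; rewrite -EFinM lee_fin mulr_ge0 ?sqr_ge0.
- by apply: measurable_funeM; apply/measurable_EFinP; exact: measurable_indic.
- by apply: (measurableT_comp (measurable_poweR 2)); exact: measurableT_comp.
move=> x _; rewrite indicE; have [xA|_] := boolP (x \in A); last by rewrite mule0 poweR_ge0.
rewrite mule1 -(powR_mulrn 2 c0) -poweR_EFin.
have sx := hA x (set_mem xA).
have s0 : (0 <= s x)%E by apply: le_trans sx; rewrite lee_fin.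
rewrite gee0_abs//; apply: gt0_ler_poweR => //.
- by rewrite in_itv /= lee_fin c0 leey.
- by rewrite in_itv /= s0 leey.
Qed.

End conclusion.

Theorem theorem7 (R : realType) (n : nat) (a : R)
    (hna : (n = 1%N /\ 1 < a) \/ ((2 <= n)%N /\ a = 2)) :
  ~ exists C : R,
      forall (f : n.-tuple R -> R[i]) (s : n.-tuple R -> \bar R),
        Lp 2%:E f -> maximal_function a f s ->
        ('N[lebesgue_measure_n R n]_2%:E [s] <= C%:E * cnorm 2%:E f)%E.
Proof.
have a1 : 1 < a by case: hna => [[]//|[_ ->]]; rewrite ltr1n.
have na : n = 1%N \/ a = 2 by case: hna => [[]|[]]; [left|right].
have n0 : (0 < n)%N by case: hna => [[->//]|[n2 _]]; exact: leq_trans n2.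
case: n n0 hna na => // m _ _ na [C hC].
have ma : m = 0%N \/ a = 2 by case: na => [[]|]; [left|right].
have [K K0 hK] := @decaying_packet0 R.
pose B := (\prod_(i < m.+1) (K ^+ 2 * pi)) `^ 2^-1.
have B0 : 0 <= B by exact: powR_ge0.
(* The absolute value keeps [D] nonnegative whatever the sign of [C]. Neither [D] nor [v] below
   involves [M], so [L] can be fixed first and [M] chosen afterwards. *)
pose D := `|C| * B.
have D0 : 0 <= D by rewrite mulr_ge0.
pose c : R := packet_floor ^+ m.+1.
have c0 : 0 < c by rewrite exprn_gt0// packet_floor_gt0.
pose v := c ^+ 2 * (4^-1) ^+ m.
have v0 : 0 < v by apply: mulr_gt0; apply: exprn_gt0 => //; rewrite invr_gt0.
(* With this choice [c ^ 2] times the measure of the box is [v * (L - 1) = 1 + D ^ 2], which exceeds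
   the allowed [D ^ 2]. *)
pose L := 1 + (1 + D ^+ 2) / v.
have L1 : 1 <= L by rewrite /L lerDl divr_ge0 ?(ltW v0)// addr_ge0 ?sqr_ge0.
have [M [M1 h1 h2]] := large_frequency _ _ a1 L1.
pose Mi := @frequencies R m M.
have Mi0 i : 0 < Mi i.
  by rewrite /Mi /frequencies; case: ifP => // _; exact: lt_le_trans ltr01 M1.
pose f := tensor (fun i => packet 0 a (Mi i)).
pose g k := tensor (fun i => packet (ln k%:R)^-1 a (Mi i)).
pose s (x : m.+1.-tuple R) := ereal_sup [set (cabs (g k x))%:E | k in [set k | (2 <= k)%N]].
have df i : decaying K (packet 0 a (Mi i)) by exact: hK.
have [_ f2] := Lp_tensor _ (fun=> K) _ (fun=> K0) df.
have prop k : propagator a (ln k%:R)^-1 f (g k) by exact: propagator_packet.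
have sf : maximal_function a f s by exists g.
have mg k : measurable_fun setT (fun x => (cabs (g k x))%:E).
  have [F _ [[mR mI _] _ _]] := prop k.
  by apply/measurable_EFinP; exact: measurable_cabs.
have ms : measurable_fun setT s.
  (* The supremum over [k >= 2] is the tail supremum of the sequence at index 2. *)
  exact: (@measurable_fun_esups _ _ _ setT (fun k x => (cabs (g k x))%:E) mg 2%N).
have := hC f s f2 sf => hN.
have hND : ('N[lebesgue_measure_n R m.+1]_2%:E [s] <= D%:E)%E.
  apply: (le_trans hN); rewrite EFinM.
  apply: (@le_trans _ _ (`|C|%:E * cnorm 2%:E f)%E).
    by rewrite lee_wpmul2r ?Lnorm_ge0// lee_fin ler_norm.
  by rewrite lee_wpmul2l ?lee_fin//; exact: (cnorm2_tensor _ (fun=> K)).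
have mA : measurable [set x : m.+1.-tuple R | forall i, @box R m L i (tnth x i)].
  rewrite (_ : [set _ | _] =
      \bigcap_(i in [set: 'I_m.+1]) ((@tnth m.+1 R)^~ i @^-1` @box R m L i)); last first.
    by apply/seteqP; split => x h i //=; exact: h.
  apply: fin_bigcap_measurable => // i _.
  by rewrite -[X in measurable X]setTI; apply: measurable_tnth => //; exact: measurable_box.
have := Lnorm2_ge_box _ _ _ _ _ mA ms (ltW c0) D0 _ hND.
rewrite lebesgue_measure_box// -EFinM lee_fin => /(_ _)/wrap[].
  move=> x xA; have [k k2 hk] := tensor_packet_lower _ _ _ _ _ ma a1 L1 M1 h1 h2 xA.
  apply: (@le_trans _ _ (cabs (g k x))%:E); first by rewrite lee_fin.
  by apply: ereal_sup_ubound; exists k.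
apply/negP; rewrite -ltNge mulrCA /L addrAC subrr add0r -/v divfK ?gt_eqF//.
by rewrite ltrDr.
Qed.
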